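(* Fix $\epsilon,\delta>0$. There exist positive constants $M,D,C$ depending only on $\epsilon$ and $\delta$ (not on $n$) such that for all sufficiently large $n$ and for every realization of $X$ with $k_X(n)\ge\delta n^2$, $$\mathbb{P}\big[X_n\hookrightarrow_{(M,D,C)}Y_n\,\big|\,X_n\big]\ge e^{-\epsilon n^2}.$$
   Context: $X$ and $Y$ are independent homogeneous Poisson point processes of intensity 1 on $\mathbb{R}^2$. $X_n$ (resp. $Y_n$) is the metric space (with the Euclidean metric) consisting of the points of $X$ (resp. $Y$) in $[0,n]^2$ together with the boundary $\partial[0,n]^2$. Two metric spaces $(X,d_X)$, $(Y,d_Y)$ are roughly isometric with parameters $(M,D,C)$ via $T:X\to Y$ if $\frac1M d_X(x_1,x_2)-D\le d_Y(T(x_1),T(x_2))\le M d_X(x_1,x_2)+D$ for all $x_1,x_2\in X$, and for every $y\in Y$ there is $x\in X$ with $d_Y(T(x),y)\le C$. $X_n\hookrightarrow_{(M,D,C)}Y_n$ denotes the event that there exists a rough isometry with parameters $(M,D,C)$ from $X_n$ to $Y_n$ which is the identity on $\partial[0,n]^2$. $k_X(n)$ is the number of unit squares $[j,j+1]\times[\ell,\ell+1]$ ($j,\ell\in\mathbb{Z}$) contained in $[0,n]^2$ that contain at least one point of $X$. The probability is conditional on $X$ (only $Y$ is random). *)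

(* Defs.v *)
From HB Require Import structures.
From mathcomp Require Import all_boot all_order all_algebra.
From mathcomp Require Import all_classical all_reals all_analysis.
Set Implicit Arguments. Unset Strict Implicit. Unset Printing Implicit Defensive.
Import Order.TTheory GRing.Theory Num.Theory.
Local Open Scope classical_set_scope.
Local Open Scope ring_scope.

Section Defs.
Variable R : realType.

Definition edist (p q : R * R) : R :=
  Num.sqrt ((p.1 - q.1) ^+ 2 + (p.2 - q.2) ^+ 2).

Definition inbox (n : nat) (p : R * R) : Prop :=
  0 <= p.1 <= n%:R /\ 0 <= p.2 <= n%:R.
Definition bdry (n : nat) (p : R * R) : Prop :=
  inbox n p /\ (p.1 = 0 \/ p.1 = n%:R \/ p.2 = 0 \/ p.2 = n%:R).

Definition Xspace (n : nat) (pts : seq (R * R)) : set (R * R) :=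
  [set p | (p \in pts /\ inbox n p) \/ bdry n p].

Definition rough_isometry (SX SY : set (R * R)) (M D C : R)
    (T : R * R -> R * R) : Prop :=
  (forall x, SX x -> SY (T x)) /\
  (forall x1 x2, SX x1 -> SX x2 ->
      edist x1 x2 / M - D <= edist (T x1) (T x2) /\
      edist (T x1) (T x2) <= M * edist x1 x2 + D) /\
  (forall y, SY y -> exists2 x, SX x & edist (T x) y <= C).

Definition embeds (n : nat) (SX SY : set (R * R)) (M D C : R) : Prop :=
  exists T, rough_isometry SX SY M D C T /\ (forall p, bdry n p -> T p = p).

Definition kX (n : nat) (pts : seq (R * R)) : nat :=
  #|[set jl : 'I_n * 'I_n |
      has (fun p : R * R =>
             [&& (jl.1)%:R <= p.1, p.1 <= (jl.1)%:R + 1,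
                 (jl.2)%:R <= p.2 & p.2 <= (jl.2)%:R + 1]) pts]|.

Definition leb2 := ((@lebesgue_measure R) \x (@lebesgue_measure R))%E.

Fixpoint tleb (k : nat) : set (k.-tuple (R * R)) -> \bar R :=
  match k as k0 return set (k0.-tuple (R * R)) -> \bar R with
  | 0%N => fun A => if `[< A [tuple] >] then 1%E else 0%E
  | k'.+1 => fun A =>
      (\int[leb2]_x tleb [set t : k'.-tuple (R * R) | A [tuple of x :: t]])%E
  end.

(* Law of a Poisson point process of intensity 1 restricted to [0,n]^2:
   the number of points is Poisson(n^2) and, given k points, they are iid
   uniform on [0,n]^2; hence
     P[E] = sum_k e^{-n^2}/k! * Leb_{2k}({(y_1..y_k) in ([0,n]^2)^k | E})
   "poisson_prob_ge n E p" says P[E] >= p, in the (conservative) inner sense: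
   there are measurable subsets B_k of the event sets whose total Poisson
   weight is >= p (equivalent to P[E] >= p when the event is measurable). *)
Definition poisson_prob_ge (n : nat) (E : seq (R * R) -> Prop) (p : R) : Prop :=
  exists B : forall k : nat, set (k.-tuple (R * R)),
    (forall k, measurable (B k) /\
       B k `<=` [set t | (forall i, inbox n (tnth t i)) /\ E (tval t)]) /\
    (p%:E <= \sum_(0 <= k <oo)
               ((expR (- (n%:R ^+ 2)) / (k`!)%:R)%:E * tleb (B k)))%E.

End Defs.

(* Main.v *)
(** Write X as a set of occupied cells of a 2^m x 2^m grid. A grid map that moves
    every point horizontally by a small multiple of a Lipschitz function u, vanishing
    near the boundary, is bi-Lipschitz and changes the number of cells hit by a set A
    by the correlation of 1_A with the x-derivative of u. To make this gain at least
    a constant times d(1 - d) 4^m, where d is the density of A, take for u a sum over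
    dyadic rectangles of "tent times trapezoid" functions weighted by the Haar
    coefficients of 1_A. The x-derivatives are orthogonal and the y-derivatives almost
    orthogonal, so the sum can be stopped where its gradient gets large while keeping
    a fixed fraction of the Haar energy (horizontal or vertical, whichever is larger).
    Iterating boundedly many such maps spreads X over a proportion 1 - eps/2 of the
    cells. If the cells are large and Y has about its expected number of points in
    each covered cell and none in the others, which has probability at least
    exp (- eps n^2), then sending each point of X into its cell is a rough isometry. *)

From HB Require Import structures.
From mathcomp Require Import all_boot all_order all_algebra.
From mathcomp Require Import all_classical all_reals all_analysis.
From mathcomp Require Import measurable_realfun ring lra zify.
Require Import Defs.
Set Implicit Arguments. Unset Strict Implicit. Unset Printing Implicit Defensive.
Import Order.TTheory GRing.Theory Num.Theory.
Local Open Scope ring_scope.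

(** * Sums over dyadic blocks *)

Section DyadicSums.
Variable R : realFieldType.
Implicit Types F : nat -> R.

(** A Lipschitz map needs a pointwise bound on the gradient of u, whereas orthogonality controls
    only its mean square. Stopping bridges the two: on the stopped cells the gradient is large, so
    by Chebyshev they are few compared with the energy kept; the dropped terms live on these cells
    alone, where the data are bounded by 1, so the energy lost is comparable to their number. The
    rectangles are two dyadic squares side by side. Comparing adjacent squares in both directions
    captures all of the variance, its diagonal part included, so one direction carries at least half
    of it. The sloping sides of a trapezoid take 1/64 of its height each. This costs little energy,
    and since 64 = 2^6, y-derivatives at least six scales apart are exactly orthogonal. A map of
    cells cannot increase the number of cells. What grows is the set of cells met by the stretched
    images of the cells of A; the map is only coarsely onto that set, which a rough isometry allows.
    Since n is arbitrary and the grid has 2^m cells per side, the mesh is a real number, known only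
    up to a factor 2. *)

Lemma sum_block L N F :
  \sum_(i < N * L) F i = \sum_(b < N) \sum_(r < L) F (b * L + r)%N.
Proof.
elim: N => [|N IH]; first by rewrite mul0n !big_ord0.
rewrite big_ord_recr /= -IH mulSnr big_split_ord /=.
by congr (_ + _).
Qed.

Lemma sum_double N F :
  \sum_(i < N.*2) F i = \sum_(b < N) (F b.*2 + F b.*2.+1).
Proof.
rewrite -muln2 sum_block; apply: eq_bigr => b _.
by rewrite !big_ord_recr big_ord0 /= add0r addn0 muln2 addn1.
Qed.

Lemma sum_pow2_block m k F : (k <= m)%N ->
  \sum_(i < 2 ^ m) F i =
  \sum_(b < 2 ^ (m - k)) \sum_(r < 2 ^ k) F (b * 2 ^ k + r)%N.
Proof. by move=> km; rewrite -sum_block -expnD subnK. Qed.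

Lemma sum_pow2_div m k F : (k <= m)%N ->
  \sum_(i < 2 ^ m) F (i %/ 2 ^ k)%N = (2 ^ k)%:R * \sum_(b < 2 ^ (m - k)) F b.
Proof.
move=> km; rewrite (sum_pow2_block (fun i => F (i %/ 2 ^ k)%N) km) mulr_sumr; apply: eq_bigr => b _.
rewrite (eq_bigr (fun=> F b)) => [|r _].
  by rewrite sumr_const card_ord mulr_natl.
by rewrite divnMDl ?expn_gt0// divn_small ?addn0.
Qed.

Lemma sum_flip_eq0 m k F : (k < m)%N ->
  (forall b r, (r < 2 ^ k)%N ->
     F (b * 2 ^ k.+1 + 2 ^ k + r)%N = - F (b * 2 ^ k.+1 + r)%N) ->
  \sum_(i < 2 ^ m) F i = 0.
Proof.
move=> km H; rewrite (sum_pow2_block _ km) big1// => b _.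
have := sum_block (2 ^ k) 2 (fun r => F (b * 2 ^ k.+1 + r)%N).
rewrite -expnS => ->; rewrite !big_ord_recr big_ord0 /= add0r -big_split /= big1// => r _.
by rewrite mul0n mul1n add0n addnA H// subrr.
Qed.

Lemma sum_blockwise_eq0 m k F (G f : nat -> R) : (k <= m)%N ->
  (forall b r, (r < 2 ^ k)%N -> F (b * 2 ^ k + r)%N = G b * f r) ->
  \sum_(r < 2 ^ k) f r = 0 ->
  \sum_(i < 2 ^ m) F i = 0.
Proof.
move=> km H s0; rewrite (sum_pow2_block _ km) big1// => b _.
rewrite (eq_bigr (fun r : 'I__ => G b * f r)) => [|r _]; last exact: H.
by rewrite -mulr_sumr s0 mulr0.
Qed.

Lemma sum_small_pow2 m n :
  \sum_(k < m | (k < n)%N) (2 ^ k)%:R <= (2 ^ n)%:R - 1 :> R.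
Proof.
rewrite -natr_sum -(@natrB _ (2 ^ n) 1) ?expn_gt0// ler_nat.
suff : (\sum_(k < m | (k < n)%N) 2 ^ k <= 2 ^ minn m n - 1)%N.
  by move/leq_trans; apply; rewrite leq_sub2r// leq_exp2l// geq_minr.
elim: m => [|m IH]; first by rewrite big_ord0.
rewrite big_mkcond big_ord_recr /= -big_mkcond /=.
apply: (leq_trans (leq_add IH (leqnn _))).
case: ifP => [mn|/negbT]; last first.
  by rewrite -leqNgt => nm; rewrite addn0 leq_sub2r// leq_exp2l//; lia.
have -> : minn m n = m by lia.
have -> : minn m.+1 n = m.+1 by lia.
have : (0 < 2 ^ m)%N by rewrite expn_gt0.
by rewrite expnS; lia.
Qed.

Lemma geometric_half_sum m b :
  \sum_(k < m | (b < k)%N) (2 ^ b)%:R / (2 ^ k)%:R <= 1 :> R.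
Proof.
suff H : \sum_(k < m | (b < k)%N) (2 ^ b)%:R / (2 ^ k)%:R <=
         1 - (if (b < m)%N then (2 ^ b.+1)%:R / (2 ^ m)%:R else 1) :> R.
  by apply: le_trans H _; rewrite gerBl; case: ifP => _; rewrite ?divr_ge0.
elim: m => [|m IH]; first by rewrite big_ord0 ltn0 subrr.
rewrite big_mkcond big_ord_recr /= -big_mkcond /=.
have p2 k : (2 ^ k)%:R != 0 :> R by rewrite pnatr_eq0 expn_eq0.
apply: (le_trans (lerD IH (lexx _))).
have [bm|bm|bm] := ltngtP b m.
- rewrite (leq_trans bm) // ?ltnS// ?leqnSn//.
  rewrite le_eqVlt; apply/orP; left; apply/eqP.
  have -> : (2 ^ b.+1)%:R = 2 * (2 ^ b)%:R :> R by rewrite expnS natrM.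
  have -> : (2 ^ m.+1)%:R = 2 * (2 ^ m)%:R :> R by rewrite expnS natrM.
  by field; rewrite p2.
- by rewrite ltnS leqNgt bm/= subrr add0r.
- by rewrite bm ltnS leqnn divff// !subrr addr0.
Qed.

(** Expand the square. Only pairs of scales less than [w] apart survive, which leaves at most
    [2 * w] partners for each scale, and a product is at most half the sum of the squares. *)
Lemma gram_band_bound (I : finType) (m w : nat) (G : nat -> I -> R) :
  (forall k k', (k' < m)%N -> (k + w <= k')%N -> \sum_i G k i * G k' i = 0) ->
  \sum_i (\sum_(k < m) G k i) ^+ 2 <=
  (2 * w)%:R * \sum_i \sum_(k < m) G k i ^+ 2.
Proof.
move=> H.
have E : \sum_i (\sum_(k < m) G k i) ^+ 2 =
    \sum_(k < m) \sum_(k' < m) \sum_i G k i * G k' i.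
  under eq_bigr => i _ do rewrite expr2 mulr_suml.
  rewrite exchange_big; apply: eq_bigr => k _ /=.
  by under eq_bigr => i _ do rewrite mulr_sumr; rewrite exchange_big.
set nr := fun k => \sum_i G k i ^+ 2.
have nr0 k : 0 <= nr k by apply: sumr_ge0 => i _; exact: sqr_ge0.
pose near (k k' : nat) := (k < k' + w)%N && (k' < k + w)%N.
have B (k k' : 'I_m) : \sum_i G k i * G k' i <=
    (if near k k' then nr k / 2 else 0) + (if near k' k then nr k' / 2 else 0).
  have -> : near k' k = near k k' by rewrite /near andbC.
  rewrite /near; case: ifP => [_|/negbT].
    rewrite /nr -mulrDl -big_split /= mulr_suml; apply: ler_sum => i _.
    have := sqr_ge0 (G k i - G k' i); nra.
  rewrite negb_and -!leqNgt addr0 => /orP[h|h]; last by rewrite H.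
  by under eq_bigr do rewrite mulrC; rewrite H.
rewrite E; apply: (@le_trans _ _ (\sum_(k < m) \sum_(k' < m)
   ((if near k k' then nr k / 2 else 0) + (if near k' k then nr k' / 2 else 0)))).
  by do 2 (apply: ler_sum => ? _).
under eq_bigr do rewrite big_split /=.
rewrite big_split /= (exchange_big _ _ _ _ _ (fun i j : 'I_m => if near j i then _ else 0)) /=.
rewrite -mulr2n.
have C (k : 'I_m) : \sum_(k' < m) (if near k k' then nr k / 2 else 0) <=
    (2 * w)%:R * (nr k / 2).
  rewrite -big_mkcond /= sumr_const -[leLHS]mulr_natl ler_wpM2r ?divr_ge0//.
  rewrite ler_nat.
  have : (#|[pred k' : 'I_m | near k k']| <= size (iota (k.+1 - w) (2 * w)))%N.
    rewrite cardE -(size_map val); apply: uniq_leq_size.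
      by rewrite map_inj_uniq ?enum_uniq//; exact: val_inj.
    move=> x /mapP[k' + ->]; rewrite mem_enum inE /near mem_iota => /andP[].
    move=> h1 h2; rewrite [\val k']/=; apply/andP; split; lia.
  by rewrite size_iota.
have -> : \sum_i \sum_(k < m) G k i ^+ 2 = \sum_(k < m) nr k.
  by rewrite exchange_big.
rewrite -[leLHS]mulr_natl !mulr_sumr.
apply: ler_sum => k _.
have := C k; lra.
Qed.

End DyadicSums.

(** * Tent and trapezoid profiles *)

Section Profiles.
Variable R : realFieldType.

(** [haar_sign k] is the forward difference of [tent k]; for [6 <= k], [dramp k] is that of
    [ramp k], a trapezoid of height 1 over a dyadic interval of length [2 ^ k]. *)
Definition haar_sign k i : R := (-1) ^+ (i %/ 2 ^ k).
Definition tent k i : R :=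
  (minn (i %% 2 ^ k.+1) (2 ^ k.+1 - i %% 2 ^ k.+1))%:R.
(* At the scales [k < 6] no ramp is needed: [tent <= 64] already bounds the
   vertical jumps. *)
Definition ramp k j : R :=
  if (k < 6)%N then 1
  else (minn (2 ^ (k - 6)) (minn (j %% 2 ^ k) (2 ^ k - j %% 2 ^ k)))%:R
       / (2 ^ (k - 6))%:R.
Definition dramp k j : R :=
  if (k < 6)%N then 0 else
  let q := ((j %/ 2 ^ (k - 6)) %% 64)%N in
  (if q == 0%N then 1 else if q == 63%N then -1 else 0) / (2 ^ (k - 6))%:R.

Lemma pow2_gt0 k : 0 < (2 ^ k)%:R :> R.
Proof. by rewrite ltr0n expn_gt0. Qed.

Lemma pow2_split k : (6 <= k)%N -> (2 ^ k = 64 * 2 ^ (k - 6))%N.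
Proof. by move=> h; rewrite -[in LHS](subnKC h) expnD. Qed.

Lemma divn_pow2_nest i i' b k : (b <= k)%N ->
  (i %/ 2 ^ b = i' %/ 2 ^ b)%N -> (i %/ 2 ^ k = i' %/ 2 ^ k)%N.
Proof. by move=> h e; rewrite -(subnKC h) expnD !divnMA e. Qed.

Lemma haar_sign_sqr k i : haar_sign k i ^+ 2 = 1.
Proof. by rewrite /haar_sign sqrr_sign. Qed.

Lemma haar_sign_norm k i : `|haar_sign k i| = 1.
Proof. by rewrite /haar_sign normrX normrN1 expr1n. Qed.

Lemma succ_divmod d i : (0 < d)%N ->
  (i.+1 %/ d = i %/ d /\ i.+1 %% d = (i %% d).+1)%N \/
  [/\ i.+1 %/ d = (i %/ d).+1, i.+1 %% d = 0%N & (i %% d).+1 = d]%N.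
Proof.
move=> d0; rewrite divnS// modnS; case: ifP => [h|_]; last by left.
right; split => //; apply/eqP; rewrite eqn_leq ltn_pmod//=.
rewrite dvdn_leq//; move: h.
by rewrite {1}(divn_eq i d) -addnS dvdn_addr// dvdn_mull.
Qed.

Lemma haar_signE k i :
  haar_sign k i = if (i %% 2 ^ k.+1 < 2 ^ k)%N then 1 else -1.
Proof.
rewrite /haar_sign {1}(divn_eq i (2 ^ k.+1)) expnS mulnA divnMDl ?expn_gt0//.
rewrite exprD mulnC exprM sqrrN expr1n expr1n mul1r.
case: ltnP => h; first by rewrite divn_small.
suff -> : ((i %% (2 * 2 ^ k)) %/ 2 ^ k = 1)%N by [].
have : (i %% (2 * 2 ^ k) < 2 * 2 ^ k)%N by rewrite ltn_pmod// muln_gt0 expn_gt0.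
move=> h2; apply/eqP; rewrite eqn_leq -ltnS ltn_divLR ?expn_gt0// h2/=.
by rewrite leq_divRL ?expn_gt0// mul1n.
Qed.

(** There is no product-rule error because [tent] vanishes at the ends of its blocks, the only
    places where the coefficient may jump. The same reason gives [ramp_step]. *)
Lemma tent_step k i (a : nat -> R) :
  a (i.+1 %/ 2 ^ k.+1)%N * tent k i.+1 - a (i %/ 2 ^ k.+1)%N * tent k i =
  a (i %/ 2 ^ k.+1)%N * haar_sign k i.
Proof.
have p0 : (0 < 2 ^ k)%N by rewrite expn_gt0.
have d0 : (0 < 2 ^ k.+1)%N by rewrite expn_gt0.
have rlt := ltn_pmod i d0.
rewrite /tent haar_signE.
have e2 : (2 ^ k.+1 = 2 * 2 ^ k)%N by rewrite expnS.
case: (succ_divmod i d0) => [[-> ->]|[-> -> hr]].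
  rewrite -mulrBr; congr (_ * _).
  case: ltnP => h.
    have -> : minn (i %% 2 ^ k.+1).+1 (2 ^ k.+1 - (i %% 2 ^ k.+1).+1) = (i %% 2 ^ k.+1).+1%N by lia.
    have -> : minn (i %% 2 ^ k.+1) (2 ^ k.+1 - i %% 2 ^ k.+1) = (i %% 2 ^ k.+1)%N by lia.
    by rewrite -natr1; lra.
  have -> : minn (i %% 2 ^ k.+1) (2 ^ k.+1 - i %% 2 ^ k.+1) =
     (minn (i %% 2 ^ k.+1).+1 (2 ^ k.+1 - (i %% 2 ^ k.+1).+1)).+1 by lia.
  by rewrite -natr1; lra.
rewrite ltnNge.
have -> : (2 ^ k <= i %% 2 ^ k.+1)%N by lia.
have -> : minn (i %% 2 ^ k.+1) (2 ^ k.+1 - i %% 2 ^ k.+1) = 1%N by lia.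
by rewrite min0n /=; lra.
Qed.

Lemma drampE k j : (6 <= k)%N ->
  dramp k j = (if (j %% 2 ^ k < 2 ^ (k - 6))%N then 1 else
    if (2 ^ k - 2 ^ (k - 6) <= j %% 2 ^ k)%N then -1 else 0) / (2 ^ (k - 6))%:R.
Proof.
move=> h; rewrite /dramp ltnNge h /=; congr (_ / _).
rewrite modn_divl -(pow2_split h).
have w0 : (0 < 2 ^ (k - 6))%N by rewrite expn_gt0.
have rl : (j %% 2 ^ k < 2 ^ k)%N by rewrite ltn_pmod ?expn_gt0.
set r := (j %% 2 ^ k)%N in rl *; set w := (2 ^ (k - 6))%N in w0 *.
have kw : (2 ^ k = 64 * w)%N by rewrite pow2_split.
rewrite -leqn0 -ltnS ltn_divLR// mul1n; case: ltnP => // wr.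
congr (if _ then _ else _).
rewrite eqn_leq -ltnS ltn_divLR// leq_divRL// -kw rl /=.
by rewrite kw; apply/idP/idP; lia.
Qed.

Lemma ramp_step k j (a : nat -> R) : (6 <= k)%N ->
  a (j.+1 %/ 2 ^ k)%N * ramp k j.+1 - a (j %/ 2 ^ k)%N * ramp k j =
  a (j %/ 2 ^ k)%N * dramp k j.
Proof.
have hk : (6 <= k)%N -> (k < 6)%N = false by move=> h; rewrite ltnNge h.
move=> h; rewrite drampE// /ramp hk//.
have w0 : (0 < 2 ^ (k - 6))%N by rewrite expn_gt0.
have W0 : (2 ^ (k - 6))%:R != 0 :> R by rewrite pnatr_eq0 -lt0n.
have kw := pow2_split h.
have d0 : (0 < 2 ^ k)%N by rewrite expn_gt0.
have rlt := ltn_pmod j d0.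
case: (succ_divmod j d0) => [[-> ->]|[-> -> hr]].
  rewrite -mulrBr -mulrBl; congr (_ * (_ * _)).
  set r := (j %% 2 ^ k)%N in rlt *.
  case: leqP => h1 /=.
    case: leqP => h2 /=.
      have e : minn (2 ^ (k - 6)) (minn r (2 ^ k - r)) =
        (minn (2 ^ (k - 6)) (minn r.+1 (2 ^ k - r.+1))).+1 by lia.
      by rewrite e -natr1; lra.
    have e : minn (2 ^ (k - 6)) (minn r (2 ^ k - r)) =
        (minn (2 ^ (k - 6)) (minn r.+1 (2 ^ k - r.+1))) by lia.
    by rewrite e subrr.
  have e : minn (2 ^ (k - 6)) (minn r.+1 (2 ^ k - r.+1)) =
        (minn (2 ^ (k - 6)) (minn r (2 ^ k - r))).+1 by lia.
  by rewrite e -natr1; lra.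
have e1 : (2 ^ (k - 6) <= j %% 2 ^ k)%N by lia.
have e2 : (2 ^ k - 2 ^ (k - 6) <= j %% 2 ^ k)%N by lia.
have e3 : minn (2 ^ (k - 6)) (minn (j %% 2 ^ k) (2 ^ k - j %% 2 ^ k)) = 1%N by lia.
rewrite ltnNge e1 /= e2 /= e3 min0n minn0 mul0r mulr0 sub0r.
by lra.
Qed.

Lemma sum_dramp k : \sum_(r < 2 ^ k) dramp k r = 0.
Proof.
case: (ltnP k 6) => h; first by rewrite big1// => r _; rewrite /dramp h.
have E (r : nat) : dramp k r = ramp k r.+1 - ramp k r.
  by have := @ramp_step k r (fun=> 1) h; rewrite !mul1r.
under eq_bigr do rewrite E.
rewrite -(big_mkord xpredT (fun r => ramp k r.+1 - ramp k r)) telescope_sumr//.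
by rewrite /ramp ltnNge h /= modnn mod0n min0n minn0 mul0r subrr.
Qed.

Lemma dramp_block k b r : dramp k (b * 2 ^ k + r) = dramp k r.
Proof.
case: (ltnP k 6) => h; first by rewrite /dramp h.
by rewrite !drampE// modnMDl.
Qed.

Lemma dramp_near k b j j' : (b + 6 <= k)%N ->
  (j %/ 2 ^ b = j' %/ 2 ^ b)%N -> dramp k j = dramp k j'.
Proof.
move=> h e; rewrite /dramp; case: ifP => // _.
by rewrite (@divn_pow2_nest j j' b (k - 6) _ e)//; lia.
Qed.

Lemma ramp_ge0_le1 k j : 0 <= ramp k j <= 1.
Proof.
rewrite /ramp; case: ifP => _; first by rewrite ler01 lexx.
by rewrite divr_ge0//= ler_pdivrMr ?pow2_gt0// mul1r ler_nat geq_minl.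
Qed.

Lemma tent_ge0_le k i : 0 <= tent k i <= (2 ^ k)%:R.
Proof.
rewrite /tent ler0n /= ler_nat.
have e2 : (2 ^ k.+1 = 2 * 2 ^ k)%N by rewrite expnS.
by lia.
Qed.

Lemma dramp_norm k j : `|dramp k j| <= 64 / (2 ^ k)%:R.
Proof.
have p := pow2_gt0 k; have p6 := pow2_gt0 (k - 6).
case: (ltnP k 6) => h; first by rewrite /dramp h normr0 divr_ge0// ltW.
have -> : 64 / (2 ^ k)%:R = (2 ^ (k - 6))%:R^-1 :> R.
  by rewrite (pow2_split h) natrM; field; rewrite gt_eqF.
rewrite drampE// normrM normfV (gtr0_norm p6) ler_piMl ?invr_ge0 ?(ltW p6)//.
by case: ifP => _; [|case: ifP => _]; rewrite ?normrN ?normr1 ?normr0.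
Qed.

Lemma tent_dramp_norm k i j : `|tent k i * dramp k j| <= 64.
Proof.
have p := pow2_gt0 k.
have /andP[t0 t1] := tent_ge0_le k i.
rewrite normrM (ger0_norm t0).
apply: (@le_trans _ _ ((2 ^ k)%:R * (64 / (2 ^ k)%:R))).
  exact: ler_pM (dramp_norm k j).
by rewrite mulrC divfK// gt_eqF.
Qed.

Lemma tent_near k b i i' : (b < k)%N ->
  (i %/ 2 ^ b.+1 = i' %/ 2 ^ b.+1)%N ->
  `|tent k i - tent k i'| <= 2 * (2 ^ b)%:R.
Proof.
move=> bk e.
have e' : (i %/ 2 ^ k.+1 = i' %/ 2 ^ k.+1)%N.
  by apply: (divn_pow2_nest _ e); rewrite ltnS ltnW.
have a1 := divn_eq i (2 ^ k.+1); have a2 := divn_eq i' (2 ^ k.+1).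
have b1 := divn_eq i (2 ^ b.+1); have b2 := divn_eq i' (2 ^ b.+1).
have c1 : (i %% 2 ^ b.+1 < 2 ^ b.+1)%N by rewrite ltn_pmod ?expn_gt0.
have c2 : (i' %% 2 ^ b.+1 < 2 ^ b.+1)%N by rewrite ltn_pmod ?expn_gt0.
have d1 : (i %% 2 ^ k.+1 < 2 ^ k.+1)%N by rewrite ltn_pmod ?expn_gt0.
have d2 : (i' %% 2 ^ k.+1 < 2 ^ k.+1)%N by rewrite ltn_pmod ?expn_gt0.
rewrite -natrM -expnS /tent ler_distl -!natrD lerBlDr -natrD !ler_nat.
rewrite e in b1; rewrite e' in a1.
move: a1 a2 b1 b2 c1 c2 d1 d2.
move: (i %% 2 ^ k.+1)%N (i' %% 2 ^ k.+1)%N (i %% 2 ^ b.+1)%N (i' %% 2 ^ b.+1)%N => r r' s s'.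
move: (i' %/ 2 ^ k.+1 * 2 ^ k.+1)%N (i' %/ 2 ^ b.+1 * 2 ^ b.+1)%N => X Y.
by move: (2 ^ k.+1)%N (2 ^ b.+1)%N => P Q; lia.
Qed.

Lemma ramp_near k b j j' : (b < k)%N ->
  (j %/ 2 ^ b = j' %/ 2 ^ b)%N ->
  `|ramp k j - ramp k j'| <= 64 * ((2 ^ b)%:R / (2 ^ k)%:R).
Proof.
move=> bk e; have p := pow2_gt0 k; have p6 := pow2_gt0 (k - 6).
rewrite /ramp; case: ltnP => h.
  by rewrite subrr normr0 mulr_ge0// divr_ge0.
have -> : 64 * ((2 ^ b)%:R / (2 ^ k)%:R) = (2 ^ b)%:R / (2 ^ (k - 6))%:R :> R.
  by rewrite (pow2_split h) natrM; field; rewrite gt_eqF.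
rewrite -mulrBl normrM normfV (gtr0_norm p6) ler_pM2r ?invr_gt0//.
have e' : (j %/ 2 ^ k = j' %/ 2 ^ k)%N by apply: (divn_pow2_nest _ e); exact: ltnW.
have a1 := divn_eq j (2 ^ k); have a2 := divn_eq j' (2 ^ k).
have b1 := divn_eq j (2 ^ b); have b2 := divn_eq j' (2 ^ b).
have c1 : (j %% 2 ^ b < 2 ^ b)%N by rewrite ltn_pmod ?expn_gt0.
have c2 : (j' %% 2 ^ b < 2 ^ b)%N by rewrite ltn_pmod ?expn_gt0.
have d1 : (j %% 2 ^ k < 2 ^ k)%N by rewrite ltn_pmod ?expn_gt0.
have d2 : (j' %% 2 ^ k < 2 ^ k)%N by rewrite ltn_pmod ?expn_gt0.
rewrite ler_distl -!natrD lerBlDr -natrD !ler_nat.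
rewrite e in b1; rewrite e' in a1.
move: a1 a2 b1 b2 c1 c2 d1 d2.
move: (j %% 2 ^ k)%N (j' %% 2 ^ k)%N (j %% 2 ^ b)%N (j' %% 2 ^ b)%N => r r' s s'.
move: (j' %/ 2 ^ k * 2 ^ k)%N (j' %/ 2 ^ b * 2 ^ b)%N => X Y.
by move: (2 ^ k)%N (2 ^ b)%N (2 ^ (k - 6))%N => P Q W; lia.
Qed.

(** Six scales up, [dramp k] takes the same value at both points and only [tent] varies. For closer
    scales [2 ^ b / 2 ^ k] is at least 1/64, and the trivial bound 128 is enough. *)
Lemma tent_dramp_near k b i i' j j' : (b < k)%N ->
  (i %/ 2 ^ b.+1 = i' %/ 2 ^ b.+1)%N -> (j %/ 2 ^ b = j' %/ 2 ^ b)%N ->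
  `|tent k i * dramp k j - tent k i' * dramp k j'| <=
  128 * 64 * ((2 ^ b)%:R / (2 ^ k)%:R).
Proof.
move=> bk ei ej.
have p := pow2_gt0 k; have pb := pow2_gt0 b.
case: (leqP (b + 6) k) => h.
  rewrite (dramp_near h ej) -mulrBl normrM.
  apply: (@le_trans _ _ ((2 * (2 ^ b)%:R) * (64 / (2 ^ k)%:R))).
    apply: ler_pM => //; [exact: tent_near | exact: dramp_norm].
  have : 0 <= (2 ^ b)%:R / (2 ^ k)%:R :> R by rewrite divr_ge0.
  lra.
apply: (@le_trans _ _ 128).
  apply: le_trans (ler_normB _ _) _.
  by have := tent_dramp_norm k i j; have := tent_dramp_norm k i' j'; lra.
rewrite mulrA ler_pdivlMr//.
have : (2 ^ k <= 64 * 2 ^ b)%N.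
  by rewrite -(@expnD 2 6 b) leq_exp2l// addnC ltnW.
rewrite -(ler_nat R) natrM; lra.
Qed.

(** Of the 64 slices of a block only the first and the last, the sloping sides, contribute. *)
Lemma sum_one_sub_ramp_sqr k :
  \sum_(r < 2 ^ k) (1 - ramp k r) ^+ 2 <= (2 ^ k)%:R / 32.
Proof.
case: (ltnP k 6) => h.
  rewrite big1 ?divr_ge0// => r _; by rewrite /ramp h subrr expr0n.
rewrite (pow2_split h) (sum_block (2 ^ (k - 6)) 64 (fun r => (1 - ramp k r) ^+ 2)).
set w := (2 ^ (k - 6))%N.
have w0 : (0 < w)%N by rewrite expn_gt0.
have W0 : w%:R != 0 :> R by rewrite pnatr_eq0 -lt0n.
rewrite big_ord_recl big_ord_recr /= (_ : \sum_(i < 62) _ = 0); last first.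
  apply: big1 => b _; apply: big1 => s _.
  rewrite /ramp ltnNge h/= -/w (pow2_split h) -/w.
  have b62 := ltn_ord b; have sw := ltn_ord s.
  rewrite /bump leq0n add1n modn_small; last by nia.
  have -> : minn w (minn (b.+1 * w + s) (64 * w - (b.+1 * w + s))) = w by nia.
  by rewrite divff// subrr expr0n.
rewrite add0r.
have B x : \sum_(s < w) (1 - ramp k (x * w + s)) ^+ 2 <= w%:R.
  apply: (@le_trans _ _ (\sum_(s < w) 1)); last by rewrite sumr_const card_ord.
  apply: ler_sum => s _; have /andP[r0 r1] := ramp_ge0_le1 k (x * w + s).
  by rewrite expr_le1//; lra.
rewrite natrM.
by have := B 0%N; have := B (lift ord0 (ord_max : 'I_63)); rewrite /=; lra.
Qed.

End Profiles.

(** * Haar coefficients and orthogonality *)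

Section BlockAverages.
Variable R : realFieldType.
Variable m : nat.
Local Notation cell := ('I_(2 ^ m) * 'I_(2 ^ m))%type.
Implicit Types g : nat -> nat -> R.

Fixpoint block_avg g (k i j : nat) : R :=
  if k is k'.+1 then
    (block_avg g k' i.*2 j.*2 + block_avg g k' i.*2 j.*2.+1 +
     block_avg g k' i.*2.+1 j.*2 + block_avg g k' i.*2.+1 j.*2.+1) / 4
  else g i j.

(** The Haar coefficient of a rectangle made of two adjacent squares of side [2 ^ k]. *)
Definition hdiff g k p q : R :=
  (block_avg g k p.*2 q - block_avg g k p.*2.+1 q) / 2.

Definition hcoef g k i j : R := hdiff g k (i %/ 2 ^ k.+1) (j %/ 2 ^ k).

(** Orthogonality uses only this property of the coefficients, so it survives a stopping rule that
    depends on [g]. *)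
Definition coarse (a : nat -> nat -> nat -> R) :=
  forall k i i' j j', (i %/ 2 ^ k.+1 = i' %/ 2 ^ k.+1)%N ->
    (j %/ 2 ^ k = j' %/ 2 ^ k)%N -> a k i j = a k i' j'.

Lemma coarse_hcoef g : coarse (hcoef g).
Proof. by move=> k i i' j j' ei ej; rewrite /hcoef ei ej. Qed.

Lemma sum_cell (F : nat -> nat -> R) :
  \sum_(z : cell) F z.1 z.2 = \sum_(i < 2 ^ m) \sum_(j < 2 ^ m) F i j.
Proof. by rewrite pair_bigA. Qed.

Lemma block_avg_norm g k i j :
  (forall i j, `|g i j| <= 1) -> `|block_avg g k i j| <= 1.
Proof.
move=> g1; elim: k i j => [|k IH] i j //=.
have := IH i.*2 j.*2; have := IH i.*2 j.*2.+1.
have := IH i.*2.+1 j.*2; have := IH i.*2.+1 j.*2.+1.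
rewrite !ler_norml => /andP[? ?] /andP[? ?] /andP[? ?] /andP[? ?].
by apply/andP; split; lra.
Qed.

Lemma hcoef_norm g k i j : (forall i j, `|g i j| <= 1) -> `|hcoef g k i j| <= 1.
Proof.
move=> g1; rewrite /hcoef /hdiff.
move: (i %/ _)%N (j %/ _)%N => p q.
have := block_avg_norm k p.*2 q g1; have := block_avg_norm k p.*2.+1 q g1.
rewrite !ler_norml => /andP[? ?] /andP[? ?].
by apply/andP; split; lra.
Qed.

Lemma block_avg_tr g k i j :
  block_avg (fun x y => g y x) k i j = block_avg g k j i.
Proof.
elim: k i j => [|k IH] i j //=; rewrite !IH; congr (_ / _).
by rewrite -!addrA; congr (_ + _); rewrite addrCA.
Qed.

Lemma sum_double2 N (F : nat -> nat -> R) :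
  \sum_(i < N.*2) \sum_(j < N.*2) F i j =
  \sum_(i < N) \sum_(j < N) (F i.*2 j.*2 + F i.*2 j.*2.+1 +
     F i.*2.+1 j.*2 + F i.*2.+1 j.*2.+1).
Proof.
rewrite (sum_double N (fun i => \sum_(j < N.*2) F i j)); apply: eq_bigr => i _.
rewrite !sum_double -big_split; apply: eq_bigr => j _ /=.
by rewrite !addrA.
Qed.

Lemma pow2_predn k : (k < m)%N -> (2 ^ (m - k) = (2 ^ (m - k.+1)).*2)%N.
Proof. by move=> km; rewrite -mul2n -expnS subnSK. Qed.

Lemma divn2_double b : (b.*2 %/ 2 = b)%N.
Proof. by rewrite divn2 doubleK. Qed.

Lemma divn2_doubleS b : (b.*2.+1 %/ 2 = b)%N.
Proof. by rewrite divn2 /= uphalf_double. Qed.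

Lemma sum_pow2_double k (F : nat -> R) : (k < m)%N ->
  \sum_(i < 2 ^ (m - k)) F i = \sum_(b < 2 ^ (m - k.+1)) (F b.*2 + F b.*2.+1).
Proof. by move=> km; rewrite pow2_predn// sum_double. Qed.

Lemma sum_block_avg g k (b : nat -> nat -> R) : (k <= m)%N ->
  \sum_(i < 2 ^ m) \sum_(j < 2 ^ m) g i j * b (i %/ 2 ^ k)%N (j %/ 2 ^ k)%N =
  (2 ^ k)%:R ^+ 2 *
  \sum_(i < 2 ^ (m - k)) \sum_(j < 2 ^ (m - k)) block_avg g k i j * b i j.
Proof.
elim: k b => [|k IH] b km.
  rewrite expn0 expr1n mul1r subn0; apply: eq_bigr => i _.
  by apply: eq_bigr => j _; rewrite !divn1.
transitivity (\sum_(i < 2 ^ m) \sum_(j < 2 ^ m)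
   g i j * b ((i %/ 2 ^ k) %/ 2)%N ((j %/ 2 ^ k) %/ 2)%N).
  by apply: eq_bigr => i _; apply: eq_bigr => j _; rewrite -!divnMA -!expnSr.
rewrite (IH (fun i j => b (i %/ 2)%N (j %/ 2)%N) (ltnW km)).
rewrite pow2_predn// (sum_double2 _ (fun i j => block_avg g k i j * b (i %/ 2)%N (j %/ 2)%N)).
have -> : (2 ^ k.+1)%:R ^+ 2 = (2 ^ k)%:R ^+ 2 * 4 :> R by rewrite expnS natrM; ring.
rewrite -[RHS]mulrA; congr (_ * _).
rewrite mulr_sumr; apply: eq_bigr => i _; rewrite mulr_sumr; apply: eq_bigr => j _ /=.
rewrite !divn2_double !divn2_doubleS.
by field.
Qed.

Lemma sum_cell_coarse k (F : nat -> nat -> R) : (k < m)%N ->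
  \sum_(i < 2 ^ m) \sum_(j < 2 ^ m) F (i %/ 2 ^ k.+1)%N (j %/ 2 ^ k)%N =
  2 * (2 ^ k)%:R ^+ 2 * \sum_(p < 2 ^ (m - k.+1)) \sum_(q < 2 ^ (m - k)) F p q.
Proof.
move=> km.
under eq_bigr do rewrite (sum_pow2_div (F _) (ltnW km)).
rewrite (sum_pow2_div (fun p => (2 ^ k)%:R * \sum_(q < 2 ^ (m - k)) F p q) km).
by rewrite -mulr_sumr expnS natrM; ring.
Qed.

(** On each rectangle [g] times the sign sums to the area times the Haar coefficient. This turns the
    correlation of [g] with an x-derivative into a sum of squares. *)
Lemma sum_haar g a k : (k < m)%N -> coarse a ->
  \sum_(z : cell) g z.1 z.2 * (a k z.1 z.2 * haar_sign R k z.1) =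
  \sum_(z : cell) a k z.1 z.2 * hcoef g k z.1 z.2.
Proof.
move=> km ca.
rewrite (sum_cell (fun i j => g i j * (a k i j * haar_sign R k i))).
rewrite (sum_cell (fun i j => a k i j * hcoef g k i j)).
pose a' p q := a k (p * 2 ^ k.+1)%N (q * 2 ^ k)%N.
have aE i j : a k i j = a' (i %/ 2 ^ k.+1)%N (j %/ 2 ^ k)%N.
  by apply: ca; rewrite mulnK ?expn_gt0.
transitivity (\sum_(i < 2 ^ m) \sum_(j < 2 ^ m) g i j *
   (fun x y => a' (x %/ 2)%N y * (-1) ^+ x) (i %/ 2 ^ k)%N (j %/ 2 ^ k)%N).
  apply: eq_bigr => i _; apply: eq_bigr => j _.
  by rewrite aE -divnMA -expnSr.
rewrite (sum_block_avg g (fun x y => a' (x %/ 2)%N y * (-1) ^+ x) (ltnW km)).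
under [RHS]eq_bigr do under eq_bigr do rewrite aE.
rewrite (sum_cell_coarse (fun p q => a' p q * hdiff g k p q) km).
rewrite (sum_pow2_double (fun i => \sum_(j < 2 ^ (m - k))
  block_avg g k i j * (a' (i %/ 2)%N j * (-1) ^+ i)) km).
rewrite [2 * _]mulrC -[RHS]mulrA; congr (_ * _); rewrite mulr_sumr; apply: eq_bigr => p _.
rewrite -big_split mulr_sumr; apply: eq_bigr => q _ /=.
rewrite divn2_double divn2_doubleS exprS -muln2 [(p * 2)%N]mulnC exprM sqrrN !expr1n.
by rewrite /hdiff mul2n; field.
Qed.

(* Each 2x2 refinement loses at most the horizontal plus the vertical pair differences. *)
Lemma variance_le g :
  \sum_(i < 2 ^ m) \sum_(j < 2 ^ m) g i j = 0 ->
  \sum_(z : cell) g z.1 z.2 ^+ 2 <=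
  \sum_(z : cell) \sum_(k < m) hcoef g k z.1 z.2 ^+ 2 +
  \sum_(z : cell) \sum_(k < m) hcoef (fun x y => g y x) k z.1 z.2 ^+ 2.
Proof.
move=> g0; set gT := fun x y => g y x.
(* [V k] is the squared norm of [g] averaged over squares of side [2 ^ k]: the full norm at 0, and
   zero at [m], where the average is over the whole grid. *)
pose V k := (2 ^ k)%:R ^+ 2 * \sum_(i < 2 ^ (m - k)) \sum_(j < 2 ^ (m - k))
  block_avg g k i j ^+ 2.
have Vm : V m = 0.
  rewrite /V subnn !big_ord_recr !big_ord0 /= !add0r.
  have := sum_block_avg g (fun _ _ => 1) (leqnn m).
  rewrite subnn !big_ord_recr !big_ord0 /= !add0r mulr1.
  under eq_bigr do under eq_bigr do rewrite mulr1.
  rewrite g0 => /esym/eqP; rewrite mulf_eq0 expf_eq0 /= pnatr_eq0 expn_eq0 /=.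
  by move=> /eqP ->; rewrite expr0n mulr0.
have V0 : V 0%N = \sum_(z : cell) g z.1 z.2 ^+ 2.
  by rewrite (sum_cell (fun i j => g i j ^+ 2)) /V expn0 expr1n mul1r subn0.
have step k : (k < m)%N -> V k <= V k.+1 +
   (\sum_(z : cell) hcoef g k z.1 z.2 ^+ 2 +
    \sum_(z : cell) hcoef gT k z.1 z.2 ^+ 2).
  move=> km.
  rewrite (sum_cell (fun i j => hcoef g k i j ^+ 2)).
  rewrite (sum_cell (fun i j => hcoef gT k i j ^+ 2)).
  rewrite (sum_cell_coarse (fun p q => hdiff g k p q ^+ 2) km).
  rewrite (sum_cell_coarse (fun p q => hdiff gT k p q ^+ 2) km).
  rewrite /V pow2_predn// (sum_double2 _ (fun i j => block_avg g k i j ^+ 2)).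
  set M := (2 ^ (m - k.+1))%N.
  have -> : \sum_(p < M) \sum_(q < M.*2) hdiff g k p q ^+ 2 =
    \sum_(p < M) \sum_(q < M) (hdiff g k p q.*2 ^+ 2 + hdiff g k p q.*2.+1 ^+ 2).
    by apply: eq_bigr => p _; rewrite (sum_double _ (fun q => hdiff g k p q ^+ 2)).
  have -> : \sum_(p < M) \sum_(q < M.*2) hdiff gT k p q ^+ 2 =
    \sum_(p < M) \sum_(q < M) (hdiff gT k q p.*2 ^+ 2 + hdiff gT k q p.*2.+1 ^+ 2).
    rewrite [RHS]exchange_big.
    by apply: eq_bigr => p _; rewrite (sum_double _ (fun q => hdiff gT k p q ^+ 2)).
  have -> : (2 ^ k.+1)%:R ^+ 2 = (2 ^ k)%:R ^+ 2 * 4 :> R by rewrite expnS natrM; ring.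
  have P0 : 0 <= (2 ^ k)%:R ^+ 2 :> R by rewrite exprn_ge0.
  move: ((2 ^ k)%:R ^+ 2) P0 => P P0.
  set S0 := (X in P * X <= _); set S1 := (X in P * 4 * X + _).
  set S2 := (X in _ + (2 * P * X + _)); set S3 := (X in _ + (_ + 2 * P * X)).
  suff /(ler_wpM2l P0) : S0 <= 4 * S1 + (2 * S2 + 2 * S3) by lra.
  rewrite !mulr_sumr -!big_split.
  apply: ler_sum => i _; rewrite !mulr_sumr -!big_split.
  apply: ler_sum => j _ /=.
  have trE x y : block_avg gT k x y = block_avg g k y x by exact: block_avg_tr.
  rewrite /hdiff !trE.
  move: (block_avg g k i.*2 j.*2) (block_avg g k i.*2 j.*2.+1) => x00 x01.
  move: (block_avg g k i.*2.+1 j.*2) (block_avg g k i.*2.+1 j.*2.+1) => x10 x11.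
  (* The two sides differ by a quarter of this square: the diagonal difference is counted once
     horizontally and once vertically. *)
  have := sqr_ge0 (x00 - x10 - x01 + x11); nra.
have all k : (k <= m)%N -> V 0%N <= V k + \sum_(k' < k)
   (\sum_(z : cell) hcoef g k' z.1 z.2 ^+ 2 +
    \sum_(z : cell) hcoef gT k' z.1 z.2 ^+ 2).
  elim: k => [_|k IH km]; first by rewrite big_ord0 addr0.
  rewrite big_ord_recr /=.
  by have := IH (ltnW km); have := step _ km; lra.
have := all _ (leqnn m); rewrite V0 Vm add0r big_split /=.
by rewrite exchange_big [X in _ + X]exchange_big.
Qed.

Lemma sum_cell_flip_eq0 k (F : nat -> nat -> R) : (k < m)%N ->
  (forall b r j, (r < 2 ^ k)%N ->
     F (b * 2 ^ k.+1 + 2 ^ k + r)%N j = - F (b * 2 ^ k.+1 + r)%N j) ->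
  \sum_(z : cell) F z.1 z.2 = 0.
Proof.
move=> km H; rewrite sum_cell exchange_big big1// => j _.
by apply: (@sum_flip_eq0 _ m k (fun i => F i j)) => // b r rk; exact: H.
Qed.

Lemma flip_divn_pow2 k b r : (r < 2 ^ k)%N ->
  ((b * 2 ^ k.+1 + 2 ^ k + r) %/ 2 ^ k.+1 = b)%N /\
  ((b * 2 ^ k.+1 + r) %/ 2 ^ k.+1 = b)%N.
Proof.
move=> rk; rewrite -addnA !divnMDl ?expn_gt0//.
have e : (2 ^ k.+1 = 2 ^ k + 2 ^ k)%N by rewrite expnS mul2n addnn.
by rewrite !divn_small ?addn0// e; lia.
Qed.

Lemma haar_sign_flip k b r : (r < 2 ^ k)%N ->
  haar_sign R k (b * 2 ^ k.+1 + 2 ^ k + r) = - haar_sign R k (b * 2 ^ k.+1 + r).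
Proof.
move=> rk; rewrite !haar_signE -addnA !modnMDl.
have e : (2 ^ k.+1 = 2 ^ k + 2 ^ k)%N by rewrite expnS mul2n addnn.
by rewrite !modn_small ?rk ?ltnNge ?leq_addr ?opprK//= e; lia.
Qed.

(** Exchanging the two halves of a rectangle flips the sign of its own scale and leaves all coarser
    scales unchanged. Distinct scales are therefore orthogonal on each row, whatever the vertical
    profile [b]. *)
Lemma haar_l2 a (b : nat -> nat -> R) : coarse a ->
  \sum_(z : cell) (\sum_(k < m) a k z.1 z.2 * (haar_sign R k z.1 * b k z.2)) ^+ 2 <=
  2 * \sum_(z : cell) \sum_(k < m) (a k z.1 z.2 * b k z.2) ^+ 2.
Proof.
move=> ca.
have := @gram_band_bound R cell m 1
  (fun k z => a k z.1 z.2 * (haar_sign R k z.1 * b k z.2)).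
move=> H; apply: le_trans (H _) _; last first.
  rewrite muln1 le_eqVlt; apply/orP; left; apply/eqP; congr (_ * _).
  apply: eq_bigr => z _; apply: eq_bigr => k _.
  by rewrite !exprMn haar_sign_sqr mul1r.
move=> k k' k'm; rewrite addn1 => kk'.
pose F i j := a k i j * (haar_sign R k i * b k j) * (a k' i j * (haar_sign R k' i * b k' j)).
apply: (@sum_cell_flip_eq0 k F); first exact: ltn_trans k'm.
move=> c r j rk; rewrite /F haar_sign_flip//.
have [e1 e2] := flip_divn_pow2 c rk.
have e : ((c * 2 ^ k.+1 + 2 ^ k + r) %/ 2 ^ k.+1 = (c * 2 ^ k.+1 + r) %/ 2 ^ k.+1)%N.
  by rewrite e1 e2.
rewrite (ca k _ (c * 2 ^ k.+1 + r)%N _ j e)//.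
rewrite (ca k' _ (c * 2 ^ k.+1 + r)%N _ j)//; last first.
  by apply: divn_pow2_nest e; rewrite ltnW.
rewrite /haar_sign (divn_pow2_nest kk' e).
by ring.
Qed.

(** Here the cancellation is vertical: [dramp k] has mean zero on blocks of height [2 ^ k], on which
    everything of scale at least [k + 6] is constant in y. The band width 6 gives 12, and 64 bounds
    each [tent] times [dramp]. *)
Lemma tent_l2 a : coarse a ->
  \sum_(z : cell) (\sum_(k < m) a k z.1 z.2 * (tent R k z.1 * dramp R k z.2)) ^+ 2 <=
  12 * 64 ^+ 2 * \sum_(z : cell) \sum_(k < m) a k z.1 z.2 ^+ 2.
Proof.
move=> ca.
have := @gram_band_bound R cell m 6
  (fun k z => a k z.1 z.2 * (tent R k z.1 * dramp R k z.2)).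
move=> H; apply: le_trans (H _) _; last first.
  rewrite -mulrA ler_wpM2l// mulr_sumr; apply: ler_sum => z _.
  rewrite mulr_sumr; apply: ler_sum => k _.
  rewrite exprMn mulrC ler_wpM2r ?sqr_ge0// -real_normK ?num_real//.
  by rewrite lerXn2r ?nnegrE//; exact: tent_dramp_norm.
move=> k k' k'm kk'.
pose F i j := a k i j * (tent R k i * dramp R k j) * (a k' i j * (tent R k' i * dramp R k' j)).
rewrite (sum_cell F) big1// => i _.
pose G b := a k i (b * 2 ^ k)%N * tent R k i * (a k' i (b * 2 ^ k)%N * (tent R k' i * dramp R k' (b * 2 ^ k))).
apply: (@sum_blockwise_eq0 _ m k (F i) G (dramp R k)); last exact: sum_dramp.
  by lia.
move=> b r rk; rewrite /F /G dramp_block.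
have e : ((b * 2 ^ k + r) %/ 2 ^ k = (b * 2 ^ k) %/ 2 ^ k)%N.
  by rewrite divnMDl ?expn_gt0// mulnK ?expn_gt0// divn_small ?addn0.
rewrite (ca k i i _ (b * 2 ^ k)%N)//.
rewrite (ca k' i i _ (b * 2 ^ k)%N)//; last by apply: divn_pow2_nest e; lia.
rewrite (dramp_near _ kk' e).
by ring.
Qed.

Lemma ramp_block k b r : ramp R k (b * 2 ^ k + r) = ramp R k r.
Proof. by rewrite /ramp modnMDl. Qed.

Lemma ramp_defect_l2 a : coarse a ->
  \sum_(z : cell) \sum_(k < m) (a k z.1 z.2 * (1 - ramp R k z.2)) ^+ 2 <=
  (\sum_(z : cell) \sum_(k < m) a k z.1 z.2 ^+ 2) / 32.
Proof.
move=> ca; rewrite exchange_big [X in _ <= X / _]exchange_big mulr_suml /=.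
apply: ler_sum => k _.
rewrite (sum_cell (fun i j => (a k i j * (1 - ramp R k j)) ^+ 2)).
rewrite (sum_cell (fun i j => a k i j ^+ 2)) mulr_suml; apply: ler_sum => i _.
have km : (k <= m)%N by rewrite ltnW.
rewrite (sum_pow2_block (fun j => (a k i j * (1 - ramp R k j)) ^+ 2) km).
rewrite (sum_pow2_block (fun j => a k i j ^+ 2) km) mulr_suml.
apply: ler_sum => b _.
have aE (r : 'I_(2 ^ k)) : a k i (b * 2 ^ k + r)%N = a k i (b * 2 ^ k)%N.
  by apply: ca; rewrite // divnMDl ?expn_gt0// mulnK ?expn_gt0// divn_small ?addn0.
under eq_bigr do rewrite aE ramp_block exprMn.
under [X in _ <= X / _]eq_bigr do rewrite aE.
rewrite -mulr_sumr sumr_const card_ord -[a k i _ ^+ 2 *+ _]mulr_natr -[leRHS]mulrA.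
by rewrite ler_wpM2l ?sqr_ge0// sum_one_sub_ramp_sqr.
Qed.

End BlockAverages.

(** * The stopped series *)

Section StoppedSeries.
Variable R : realFieldType.
Variable m : nat.
Variable g : nat -> nat -> R.
Hypothesis g1 : forall i j, `|g i j| <= 1.
Local Notation cell := ('I_(2 ^ m) * 'I_(2 ^ m))%type.
Local Notation c := (hcoef g).

(** [gradx b] and [grady b] are the formal derivatives of the unstopped series restricted to scales
    from [b] up. If [b] is the scale at which a cell is cut, they are the sums that the stopped
    series leaves there. *)
Definition gradx b i j : R :=
  \sum_(k < m | (b <= k)%N) c k i j * (haar_sign R k i * ramp R k j).
Definition grady b i j : R :=
  \sum_(k < m | (b <= k)%N) c k i j * (tent R k i * dramp R k j).

(** Testing the gradient at the lower left corner makes [tame] depend on the rectangle alone, so the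
    stopped coefficients remain [coarse]. *)
Definition repx k i := (i %/ 2 ^ k.+1 * 2 ^ k.+1)%N.
Definition repy k j := (j %/ 2 ^ k * 2 ^ k)%N.

Definition tame k i j : bool :=
  (`|gradx k.+1 (repx k i) (repy k j)| <= 150 * 64) &&
  (`|grady k.+1 (repx k i) (repy k j)| <= 150 * 64).

(* Stopping rule: a rectangle is dropped as soon as the gradient accumulated
   over the strictly larger scales has become large on it or on an ancestor. *)
Definition alive k i j : bool :=
  [forall k' : 'I_m, (k <= k')%N ==> tame k' i j].

Definition acoef k i j : R := if alive k i j then c k i j else 0.

Lemma alive_coarse k i i' j j' : (i %/ 2 ^ k.+1 = i' %/ 2 ^ k.+1)%N ->
  (j %/ 2 ^ k = j' %/ 2 ^ k)%N -> alive k i j = alive k i' j'.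
Proof.
move=> ei ej; apply: eq_forallb => k'; case: (leqP k k') => //= kk'.
rewrite /tame /repx /repy (@divn_pow2_nest i i' k.+1 k'.+1)//.
by rewrite (divn_pow2_nest kk' ej).
Qed.

Lemma coarse_acoef : coarse acoef.
Proof.
move=> k i i' j j' ei ej; rewrite /acoef (alive_coarse ei ej).
by rewrite (coarse_hcoef g ei ej).
Qed.

Lemma alive_leq k k' i j : (k <= k')%N -> alive k i j -> alive k' i j.
Proof.
move=> kk' /forallP h; apply/forallP => x; apply/implyP => k'x.
by move: (h x); rewrite (leq_trans kk' k'x).
Qed.

Lemma aliveS k i j : (k < m)%N -> alive k i j = tame k i j && alive k.+1 i j.
Proof.
move=> km; apply/idP/andP => [h|[h1 h2]].
  split; last exact: alive_leq h.
  by move/forallP: h => /(_ (Ordinal km)); rewrite /= leqnn.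
apply/forallP => x; apply/implyP; rewrite leq_eqVlt => /orP[/eqP <-//|kx].
by move/forallP: h2 => /(_ x); rewrite kx.
Qed.

Lemma acoef_norm k i j : `|acoef k i j| <= 1.
Proof. by rewrite /acoef; case: ifP => _; rewrite ?normr0// hcoef_norm. Qed.

Lemma geometric_bound (f : nat -> R) (C : R) b : 0 <= C ->
  (forall k, (b < k)%N -> `|f k| <= C * ((2 ^ b)%:R / (2 ^ k)%:R)) ->
  `|\sum_(k < m | (b < k)%N) f k| <= C.
Proof.
move=> C0 H; apply: le_trans (ler_norm_sum _ _ _) _.
apply: (@le_trans _ _ (\sum_(k < m | (b < k)%N) C * ((2 ^ b)%:R / (2 ^ k)%:R))).
  by apply: ler_sum => k bk; exact: H.
by rewrite -mulr_sumr ler_piMr// geometric_half_sum.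
Qed.

Lemma repx_div k i : (repx k i %/ 2 ^ k.+1 = i %/ 2 ^ k.+1)%N.
Proof. by rewrite /repx mulnK ?expn_gt0. Qed.

Lemma repy_div k j : (repy k j %/ 2 ^ k = j %/ 2 ^ k)%N.
Proof. by rewrite /repy mulnK ?expn_gt0. Qed.

(** On a rectangle of scale [b] the coefficients and signs of larger scales are constant, and their
    ramps vary by at most [64 * 2 ^ b / 2 ^ k], a geometric series in [k]. *)
Lemma gradx_osc b i j :
  `|gradx b.+1 i j - gradx b.+1 (repx b i) (repy b j)| <= 128 * 64.
Proof.
rewrite /gradx -sumrB; apply: (@le_trans _ _ 64); last by lra.
apply: (@geometric_bound (fun k => c k i j * (haar_sign R k i * ramp R k j) -
  c k (repx b i) (repy b j) * (haar_sign R k (repx b i) * ramp R k (repy b j)))) => // k bk.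
have ei := repx_div b i; have ej := repy_div b j.
rewrite (@coarse_hcoef _ g k (repx b i) i (repy b j) j); first last.
- exact: (divn_pow2_nest (ltnW bk) ej).
- by apply: (divn_pow2_nest _ ei); rewrite ltnS ltnW.
have -> : haar_sign R k (repx b i) = haar_sign R k i.
  by rewrite /haar_sign (divn_pow2_nest bk ei).
rewrite -!mulrBr normrM [`|haar_sign _ _ _ * _|]normrM haar_sign_norm mul1r.
apply: (@le_trans _ _ (1 * `|ramp R k j - ramp R k (repy b j)|)).
  by apply: ler_wpM2r => //; exact: hcoef_norm.
by rewrite mul1r; apply: ramp_near.
Qed.

Lemma grady_osc b i j :
  `|grady b.+1 i j - grady b.+1 (repx b i) (repy b j)| <= 128 * 64.
Proof.
rewrite /grady -sumrB.
apply: (@geometric_bound (fun k => c k i j * (tent R k i * dramp R k j) -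
  c k (repx b i) (repy b j) * (tent R k (repx b i) * dramp R k (repy b j)))) => [|k bk].
  by lra.
have ei := repx_div b i; have ej := repy_div b j.
rewrite (@coarse_hcoef _ g k (repx b i) i (repy b j) j); first last.
- exact: (divn_pow2_nest (ltnW bk) ej).
- by apply: (divn_pow2_nest _ ei); rewrite ltnS ltnW.
rewrite -mulrBr normrM.
apply: (@le_trans _ _ (1 * `|tent R k i * dramp R k j -
   tent R k (repx b i) * dramp R k (repy b j)|)).
  by apply: ler_wpM2r => //; exact: hcoef_norm.
by rewrite mul1r; apply: tent_dramp_near.
Qed.

Lemma sum_geqS (f : nat -> R) b : (b < m)%N ->
  \sum_(k < m | (b <= k)%N) f k = f b + \sum_(k < m | (b < k)%N) f k.
Proof.
move=> bm; rewrite (bigD1 (Ordinal bm)) //=; congr (_ + _).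
by apply: eq_bigl => k; rewrite ltn_neqAle andbC eq_sym.
Qed.

(** The live scales of a cell are those from some [b] up. If [b < m], scale [b] is tame, so the
    gradient is at most the threshold 150 * 64, plus the oscillation 128 * 64, plus one term of size
    at most 64. If [b > 0], scale [b - 1] is not tame, so some derivative exceeds (150 - 128) *
    64. *)
Lemma cut_level i j : exists2 b, (b <= m)%N &
  [/\ forall k, (k < m)%N -> alive k i j = (b <= k)%N,
      `|gradx b i j| <= 300 * 64, `|grady b i j| <= 300 * 64 &
      b != 0%N -> (8 * 64) ^+ 2 <= gradx b i j ^+ 2 + grady b i j ^+ 2].
Proof.
have alm : alive m i j by apply/forallP => k; rewrite leqNgt ltn_ord.
have ex : exists b, alive b i j by exists m.
case: (ex_minnP ex) => b ab minb.
have bm : (b <= m)%N by exact: minb.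
exists b => //; split.
- move=> k km; apply/idP/idP => [|bk]; [exact: minb | exact: alive_leq ab].
- move: bm; rewrite leq_eqVlt => /orP[/eqP ->|bm].
    rewrite /gradx big1 => [|k]; first by rewrite normr0; lra.
    by rewrite leqNgt ltn_ord.
  rewrite /gradx (sum_geqS (fun k => c k i j * (haar_sign R k i * ramp R k j)) bm).
  move: ab; rewrite aliveS// => /andP[/andP[tx _] _].
  have ox := gradx_osc b i j.
  have : `|c b i j * (haar_sign R b i * ramp R b j)| <= 1.
    rewrite normrM [`|haar_sign _ _ _ * _|]normrM haar_sign_norm mul1r.
    have /andP[r0 r1] := ramp_ge0_le1 R b j.
    by rewrite (ger0_norm r0); apply: mulr_ile1 => //; exact: hcoef_norm.
  move: tx ox; rewrite -/(gradx b.+1 i j).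
  by rewrite !ler_norml => /andP[? ?] /andP[? ?] /andP[? ?]; apply/andP; split; lra.
- move: bm; rewrite leq_eqVlt => /orP[/eqP ->|bm].
    rewrite /grady big1 => [|k]; first by rewrite normr0; lra.
    by rewrite leqNgt ltn_ord.
  rewrite /grady (sum_geqS (fun k => c k i j * (tent R k i * dramp R k j)) bm).
  move: ab; rewrite aliveS// => /andP[/andP[_ ty] _].
  have oy := grady_osc b i j.
  have : `|c b i j * (tent R b i * dramp R b j)| <= 1 * 64.
    rewrite normrM ler_pM// ?hcoef_norm//; exact: tent_dramp_norm.
  move: ty oy; rewrite -/(grady b.+1 i j).
  by rewrite !ler_norml => /andP[? ?] /andP[? ?] /andP[? ?]; apply/andP; split; lra.
- case: b ab minb bm => // b ab minb bm _.
  have : ~~ alive b i j by apply/negP => /minb; rewrite ltnn.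
  rewrite aliveS// ab andbT negb_and -!ltNge.
  have ox := gradx_osc b i j; have oy := grady_osc b i j.
  have sq (x y z : R) : 150 * 64 < `|x| -> `|y - x| <= 128 * 64 ->
      (8 * 64) ^+ 2 <= y ^+ 2 + z ^+ 2.
    move=> hx hy; apply: (@le_trans _ _ (y ^+ 2)); last by rewrite lerDl sqr_ge0.
    rewrite -[y ^+ 2]real_normK ?num_real// lerXn2r ?nnegrE ?mulr_ge0//.
    have := ler_normB y (y - x); rewrite opprB addrC subrK; lra.
  case/orP => h; first exact: sq h ox.
  by rewrite addrC; exact: sq h oy.
Qed.

Definition upot i j : R := \sum_(k < m) acoef k i j * (tent R k i * ramp R k j).

Lemma sum_alive (f : nat -> R) i j b :
  (forall k, (k < m)%N -> alive k i j = (b <= k)%N) ->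
  \sum_(k < m) acoef k i j * f k = \sum_(k < m | (b <= k)%N) c k i j * f k.
Proof.
move=> H; rewrite [RHS]big_mkcond; apply: eq_bigr => k _.
by rewrite /acoef H//; case: ifP => _ //; rewrite mul0r.
Qed.

Lemma upot_dx i j :
  upot i.+1 j - upot i j = \sum_(k < m) acoef k i j * (haar_sign R k i * ramp R k j).
Proof.
rewrite /upot -sumrB; apply: eq_bigr => k _.
have := tent_step k i (fun p => acoef k (p * 2 ^ k.+1) j).
rewrite (coarse_acoef (repx_div k i) (erefl (j %/ 2 ^ k)%N)).
rewrite (coarse_acoef (repx_div k i.+1) (erefl (j %/ 2 ^ k)%N)).
by rewrite !mulrA -mulrBl => ->.
Qed.

(** The error comes from the scales below 6, which have no ramp: there the coefficient may jump by 2
    between rows, and [tent] is at most [2 ^ k]. *)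
Lemma upot_dy i j : `|upot i j.+1 - upot i j -
  \sum_(k < m) acoef k i j * (tent R k i * dramp R k j)| <= 2 * 64.
Proof.
rewrite /upot -!sumrB; apply: le_trans (ler_norm_sum _ _ _) _.
apply: (@le_trans _ _ (\sum_(k < m | (k < 6)%N) 2 * (2 ^ k)%:R)); last first.
  rewrite -mulr_sumr; have := sum_small_pow2 R m 6.
  have -> : (2 ^ 6)%:R = 64 :> R by [].
  by lra.
rewrite [leRHS]big_mkcond; apply: ler_sum => k _.
case: ltnP => h; last first.
  have := ramp_step j (fun q => acoef k i (q * 2 ^ k)) h.
  rewrite (coarse_acoef (erefl (i %/ 2 ^ k.+1)%N) (repy_div k j)).
  rewrite (coarse_acoef (erefl (i %/ 2 ^ k.+1)%N) (repy_div k j.+1)) => E.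
  rewrite !(mulrCA (acoef _ _ _)) -!mulrBr E subrr mulr0 normr0//.
rewrite /ramp /dramp h !mulr1 !mulr0 subr0 -mulrBl normrM.
have /andP[t0 t1] := tent_ge0_le R k i.
rewrite (ger0_norm t0) ler_pM//.
have := acoef_norm k i j; have := acoef_norm k i j.+1.
by rewrite !ler_norml => /andP[? ?] /andP[? ?]; apply/andP; split; lra.
Qed.

Lemma upot_dx_norm i j : `|upot i.+1 j - upot i j| <= 400 * 64.
Proof.
rewrite upot_dx; have [b _ [bE hx _ _]] := cut_level i j.
rewrite (@sum_alive (fun k => haar_sign R k i * ramp R k j) i j b bE).
by apply: le_trans hx _; lra.
Qed.

Lemma upot_dy_norm i j : `|upot i j.+1 - upot i j| <= 400 * 64.
Proof.
have := upot_dy i j; have [b _ [bE _ hy _]] := cut_level i j.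
rewrite (@sum_alive (fun k => tent R k i * dramp R k j) i j b bE).
move: hy; rewrite -/(grady b i j) !ler_norml => /andP[? ?] /andP[? ?].
by apply/andP; split; lra.
Qed.

Lemma upot_bottom_top i j : (2 ^ m %| j)%N -> `|upot i j| <= 64.
Proof.
move=> mj; rewrite /upot; apply: le_trans (ler_norm_sum _ _ _) _.
apply: (@le_trans _ _ (\sum_(k < m | (k < 6)%N) (2 ^ k)%:R)); last first.
  have := sum_small_pow2 R m 6.
  have -> : (2 ^ 6)%:R = 64 :> R by [].
  by lra.
rewrite [leRHS]big_mkcond; apply: ler_sum => k _.
have /andP[t0 t1] := tent_ge0_le R k i.
rewrite /ramp; case: ltnP => h.
  rewrite mulr1 normrM (ger0_norm t0) -[leRHS]mul1r ler_pM// acoef_norm//.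
have /eqP -> : (2 ^ k %| j)%N.
  by apply: dvdn_trans mj; rewrite dvdn_exp2l// ltnW.
by rewrite min0n minn0 mul0r !mulr0 normr0.
Qed.

Lemma upot_left_right i j : (2 ^ m %| i)%N -> upot i j = 0.
Proof.
move=> mi; rewrite /upot big1// => k _; rewrite /tent.
have /eqP -> : (2 ^ k.+1 %| i)%N by apply: dvdn_trans mi; rewrite dvdn_exp2l.
by rewrite min0n mul0r mulr0.
Qed.

Definition energy : R := \sum_(z : cell) \sum_(k < m) acoef k z.1 z.2 ^+ 2.
Definition stopped : {set cell} := [set z : cell | ~~ alive 0 z.1 z.2].

Lemma energy_ge0 : 0 <= energy.
Proof. by apply: sumr_ge0 => z _; apply: sumr_ge0 => k _; exact: sqr_ge0. Qed.

(** Chebyshev: the squared gradient is at least [(8 * 64) ^+ 2] on each stopped cell and totals at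
    most [2 + 12 * 64 ^+ 2] times the energy. The factor 8 suffices because its square exceeds 2 *
    12 with room to spare. *)
Lemma card_stopped : 2 * #|stopped|%:R <= energy.
Proof.
have H : #|stopped|%:R * (8 * 64) ^+ 2 <= (2 + 12 * 64 ^+ 2) * energy.
  have cr : coarse acoef := coarse_acoef.
  have hx := @haar_l2 R m acoef (ramp R) cr.
  have hy := @tent_l2 R m acoef cr.
  have hx' : \sum_(z : cell) \sum_(k < m) (acoef k z.1 z.2 * ramp R k z.2) ^+ 2 <= energy.
    apply: ler_sum => z _; apply: ler_sum => k _.
    have /andP[r0 r1] := ramp_ge0_le1 R k z.2.
    by rewrite exprMn ler_piMr ?sqr_ge0// expr_le1.
  have : #|stopped|%:R * (8 * 64) ^+ 2 <= \sum_(z : cell)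
     ((\sum_(k < m) acoef k z.1 z.2 * (haar_sign R k z.1 * ramp R k z.2)) ^+ 2 +
      (\sum_(k < m) acoef k z.1 z.2 * (tent R k z.1 * dramp R k z.2)) ^+ 2).
    rewrite mulr_natl -sumr_const big_mkcond /=; apply: ler_sum => z _.
    have [b bm [bE _ _ hb]] := cut_level z.1 z.2.
    rewrite (@sum_alive (fun k => haar_sign R k z.1 * ramp R k z.2) _ _ b bE).
    rewrite (@sum_alive (fun k => tent R k z.1 * dramp R k z.2) _ _ b bE).
    rewrite inE; case: ifP => [nal|_]; last by rewrite addr_ge0// sqr_ge0.
    apply: hb; apply: contraNneq nal => b0.
    case: (posnP m) => [m0|m0]; last by rewrite bE// b0.
    by apply/forallP => -[k km]; exfalso; move: km; rewrite m0.
  rewrite big_split /= => /le_trans; apply.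
  by move: hx hy hx'; rewrite -/energy; lra.
have := energy_ge0; nra.
Qed.

(** By duality the dropped energy [Z'] is the pairing of [g] with the dropped series [F], which
    vanishes off the stopped cells and has squared norm at most [2 * Z']. As [g] is bounded by 1,
    Young's inequality gives [Z' <= #|stopped| + Z' / 2]. *)
Lemma lost_energy :
  \sum_(z : cell) \sum_(k < m) c k z.1 z.2 ^+ 2 <= energy + 2 * #|stopped|%:R.
Proof.
pose d k i j : R := if alive k i j then 0 else c k i j.
have cd : coarse d.
  move=> k i i' j j' ei ej; rewrite /d (alive_coarse ei ej).
  by rewrite (coarse_hcoef g ei ej).
pose Z' : R := \sum_(z : cell) \sum_(k < m) d k z.1 z.2 ^+ 2.
have -> : \sum_(z : cell) \sum_(k < m) c k z.1 z.2 ^+ 2 = energy + Z'.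
  rewrite /energy /Z' -big_split; apply: eq_bigr => z _ /=.
  rewrite -big_split; apply: eq_bigr => k _ /=.
  by rewrite /acoef /d; case: ifP => _; rewrite expr0n ?addr0 ?add0r.
pose F i j := \sum_(k < m) d k i j * (haar_sign R k i * 1).
have EZ : Z' = \sum_(z : cell) g z.1 z.2 * F z.1 z.2.
  transitivity (\sum_(k < m) \sum_(z : cell) d k z.1 z.2 * c k z.1 z.2).
    rewrite /Z' exchange_big; apply: eq_bigr => k _; apply: eq_bigr => z _.
    by rewrite /d expr2; case: ifP => _; rewrite ?mul0r.
  under eq_bigr do rewrite -sum_haar//.
  rewrite exchange_big; apply: eq_bigr => z _; rewrite /F mulr_sumr.
  by apply: eq_bigr => k _; rewrite mulr1.
have FL : \sum_(z : cell) F z.1 z.2 ^+ 2 <= 2 * Z'.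
  apply: le_trans (@haar_l2 R m d (fun _ _ => 1) cd) _.
  by under eq_bigr do under eq_bigr do rewrite mulr1.
have : Z' <= #|stopped|%:R + (\sum_(z : cell) F z.1 z.2 ^+ 2) / 4.
  rewrite EZ -sumr_const [X in _ <= X + _]big_mkcond mulr_suml -big_split; apply: ler_sum => z _ /=.
  rewrite inE; case: ifP => [_|/negbFE al].
    have := sqr_ge0 (g z.1 z.2 - F z.1 z.2 / 2).
    have : g z.1 z.2 ^+ 2 <= 1.
      by rewrite -[_ ^+ 2]real_normK ?num_real// expr_le1.
    nra.
  have -> : F z.1 z.2 = 0.
    rewrite /F big1// => k _; rewrite /d (alive_leq _ al)// mul0r//.
  by rewrite mulr0 expr0n mul0r addr0.
lra.
Qed.

(** With 1 in place of [ramp] the gain would be exactly [energy]. The sloping sides cost at most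
    [energy / 4] plus 1/16 of the variance, and [energy] is at least a quarter of the variance by
    [card_stopped] and [lost_energy]. *)
Lemma upot_gain :
  \sum_(z : cell) g z.1 z.2 ^+ 2 <=
    2 * \sum_(z : cell) \sum_(k < m) c k z.1 z.2 ^+ 2 ->
  (\sum_(z : cell) g z.1 z.2 ^+ 2) / 8 <=
  \sum_(z : cell) g z.1 z.2 * (upot z.1.+1 z.2 - upot z.1 z.2).
Proof.
move=> hV.
have cr : coarse acoef := coarse_acoef.
pose F i j := \sum_(k < m) acoef k i j * (haar_sign R k i * (1 - ramp R k j)).
have E : \sum_(z : cell) g z.1 z.2 * (upot z.1.+1 z.2 - upot z.1 z.2) =
   energy - \sum_(z : cell) g z.1 z.2 * F z.1 z.2.
  have -> : energy = \sum_(k < m) \sum_(z : cell) acoef k z.1 z.2 * c k z.1 z.2.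
    rewrite /energy exchange_big; apply: eq_bigr => k _; apply: eq_bigr => z _.
    by rewrite /acoef expr2; case: ifP => _; rewrite ?mul0r.
  under [X in _ = X - _]eq_bigr do rewrite -sum_haar//.
  rewrite exchange_big -sumrB; apply: eq_bigr => z _ /=.
  rewrite upot_dx /F -mulr_sumr -mulrBr -sumrB; congr (_ * _).
  by apply: eq_bigr => k _; ring.
have FL : \sum_(z : cell) F z.1 z.2 ^+ 2 <= energy / 16.
  have := @haar_l2 R m acoef (fun k j => 1 - ramp R k j) cr.
  have := @ramp_defect_l2 R m acoef cr.
  by rewrite -/energy /F; lra.
have gF : \sum_(z : cell) g z.1 z.2 * F z.1 z.2 <=
    (\sum_(z : cell) g z.1 z.2 ^+ 2) / 16 + 4 * \sum_(z : cell) F z.1 z.2 ^+ 2.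
  rewrite mulr_suml mulr_sumr -big_split; apply: ler_sum => z _ /=.
  by have := sqr_ge0 (g z.1 z.2 / 4 - 2 * F z.1 z.2); nra.
rewrite E; have := card_stopped; have := lost_energy; lra.
Qed.

End StoppedSeries.

(** * Spreading a set of cells *)

Section Counting.
Variable R : realFieldType.

(** Retraction onto the unit interval at [c]: its increment along an interval is the length lying in
    that cell. *)
Definition clip (c : nat) (x : R) := Num.min (Num.max x c%:R) (c%:R + 1).

Lemma clip_le_lower c x : x <= c%:R -> clip c x = c%:R.
Proof. by move=> h; rewrite /clip max_r// min_l//; lra. Qed.

Lemma clip_ge_upper c x : c%:R + 1 <= x -> clip c x = c%:R + 1.
Proof. by move=> h; rewrite /clip max_l ?min_r//; lra. Qed.

Lemma clip_bounds c x : c%:R <= clip c x <= c%:R + 1.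
Proof.
by rewrite /clip le_min le_max lexx orbT ge_min lexx orbT andbT lerDl ler01.
Qed.

Lemma clip_homo c x y : x <= y -> clip c x <= clip c y.
Proof. by move=> h; apply: le_min2 => //; apply: le_max2. Qed.

Lemma sum_clip N x : 0 <= x -> \sum_(c < N) (clip c x - c%:R) = Num.min x N%:R.
Proof.
move=> x0; elim: N => [|N IH]; first by rewrite big_ord0 min_r.
rewrite big_ord_recr /= IH -natr1 /clip.
case: (leP x N%:R) => h; first by rewrite !min_l; lra.
by case: (leP x (N%:R + 1)) => h'; lra.
Qed.

(* Measuring by unit cells: the intervals [F i, F i+1) are disjoint, and each
   unit cell can absorb at most total length one of them. *)
Lemma hit_cells_ge N (F : nat -> R) (P : nat -> bool) :
  F 0%N = 0 -> F N = N%:R -> (forall i, F i <= F i.+1) ->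
  \sum_(i < N | P i) (F i.+1 - F i) <=
  \sum_(c < N) [exists i : 'I_N, [&& P i, F i < c%:R + 1 & c%:R < F i.+1]]%:R.
Proof.
move=> F0 FN Fmon.
have Fh i j : (i <= j)%N -> F i <= F j.
  by move=> /subnK <-; elim: (j - i)%N => // k; rewrite addSn => /le_trans; apply.
have F_ge0 i : 0 <= F i by rewrite -F0 Fh.
have E (i : 'I_N) : F i.+1 - F i = \sum_(c < N) (clip c (F i.+1) - clip c (F i)).
  transitivity (\sum_(c < N) ((clip c (F i.+1) - c%:R) - (clip c (F i) - c%:R))).
    rewrite sumrB !sum_clip// !min_l// -FN Fh//; exact: ltnW.
  by apply: eq_bigr => c _; ring.
under eq_bigr do rewrite E.
rewrite exchange_big; apply: ler_sum => c _.
case: (boolP [exists i, _]) => h.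
  apply: (@le_trans _ _ (\sum_(i < N) (clip c (F i.+1) - clip c (F i)))).
    rewrite [leRHS](bigID (fun i : 'I_N => P i)) /= lerDl sumr_ge0// => i _.
    by rewrite subr_ge0 clip_homo.
  rewrite -(big_mkord xpredT (fun i => clip c (F i.+1) - clip c (F i))).
  rewrite (telescope_sumr (fun i => clip c (F i)))//.
  have /andP[_ h1] := clip_bounds c (F N); have /andP[h2 _] := clip_bounds c (F 0%N).
  by rewrite /=; lra.
rewrite big1// => i Pi; move: h; rewrite negb_exists => /forallP/(_ i).
rewrite Pi /= negb_and -!leNgt => /orP[h|h].
  by rewrite !clip_ge_upper ?subrr// (le_trans h).
by rewrite !clip_le_lower ?subrr// (le_trans _ h).
Qed.

Lemma lipschitz_nat (f : nat -> R) L : (forall i, `|f i.+1 - f i| <= L) ->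
  forall i j, `|f i - f j| <= L * `|i%:R - j%:R|.
Proof.
move=> H.
have A i d : `|f (d + i)%N - f i| <= L * d%:R.
  elim: d => [|d IH]; first by rewrite add0n subrr normr0 mulr0.
  rewrite -natr1 mulrDr mulr1 addSn.
  have := ler_normD (f (d + i)%N.+1 - f (d + i)%N) (f (d + i)%N - f i).
  by rewrite addrA subrK; have := H (d + i)%N; lra.
move=> i j; wlog ij : i j / (j <= i)%N => [h|].
  case: (leqP j i) => [/h//|/ltnW/h]; by rewrite distrC [X in _ * X]distrC.
have := A j (i - j)%N; rewrite subnK// -natrB//.
by rewrite [`|(i - j)%:R|]ger0_norm.
Qed.

End Counting.

(** * Coarse isometries of the grid of cells *)

Section CellMaps.
Variable R : realType.

Definition cdist N (z z' : 'I_N * 'I_N) : R :=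
  `|z.1%:R - z'.1%:R| + `|z.2%:R - z'.2%:R|.

Definition edge_cell N (z : 'I_N * 'I_N) : bool :=
  [|| z.1 == 0%N :> nat, z.1.+1 == N, z.2 == 0%N :> nat | z.2.+1 == N].

Definition coarse_iso N (M D E : R) (phi : 'I_N * 'I_N -> 'I_N * 'I_N) : Prop :=
  (forall z z', cdist (phi z) (phi z') <= M * cdist z z' + D /\
                cdist z z' <= M * cdist (phi z) (phi z') + D) /\
  (forall z, edge_cell z -> cdist (phi z) z <= E).

(** The image of [A] is only required to be coarsely dense in [B], which may have more cells than
    [A]. *)
Definition spreads N (A B : {set 'I_N * 'I_N}) (M D E C : R) : Prop :=
  exists phi, [/\ coarse_iso M D E phi,
    forall z, z \in A -> phi z \in B &
    forall c, c \in B -> exists2 z, z \in A & cdist c (phi z) <= C].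

Lemma cdist_tri N (x y z : 'I_N * 'I_N) : cdist x z <= cdist x y + cdist y z.
Proof.
rewrite /cdist; have := ler_distD y.1%:R x.1%:R (z.1%:R : R).
by have := ler_distD y.2%:R x.2%:R (z.2%:R : R); lra.
Qed.

Lemma spreads_comp N (A1 A2 A3 : {set 'I_N * 'I_N}) M D E C M' D' E' C' :
  0 <= M -> 0 <= D -> 0 <= M' -> 0 <= D' ->
  spreads A1 A2 M D E C -> spreads A2 A3 M' D' E' C' ->
  spreads A1 A3 (M * M') (M' * D + D' + M * D' + D) (M' * E + D' + E')
    (C' + M' * C + D').
Proof.
move=> M0 D0 M0' D0' [f [[fl fe] fA fC]] [h [[hl he] hA hC]].
exists (h \o f); split; first split.
- move=> z z' /=; have [a1 a2] := fl z z'; have [b1 b2] := hl (f z) (f z').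
  have c1 := ler_wpM2l M0' a1; have c2 := ler_wpM2l M0 b2.
  have d1 : 0 <= M * D' by rewrite mulr_ge0.
  have d2 : 0 <= M' * D by rewrite mulr_ge0.
  by split; lra.
- move=> z ez /=; have a := fe _ ez; have b := he _ ez.
  have [c1 _] := hl (f z) z; have c2 := ler_wpM2l M0' a.
  by have := cdist_tri (h (f z)) (h z) z; lra.
- by move=> z /fA /hA.
- move=> c /hC[z1 /fC[z0 z0A a] b]; exists z0 => //=.
  have [c1 _] := hl z1 (f z0); have c2 := ler_wpM2l M0' a.
  by have := cdist_tri c (h z1) (h (f z0)); lra.
Qed.

Definition swap N (z : 'I_N * 'I_N) : 'I_N * 'I_N := (z.2, z.1).

Lemma swapK N : involutive (@swap N).
Proof. by case. Qed.

Lemma cdist_swap N (z z' : 'I_N * 'I_N) : cdist (swap z) (swap z') = cdist z z'.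
Proof. by rewrite /cdist /= addrC. Qed.

Lemma edge_cell_swap N (z : 'I_N * 'I_N) : edge_cell (swap z) = edge_cell z.
Proof.
by rewrite /edge_cell /=; do 4 case: (_ == _).
Qed.

Lemma spreads_swap N (A B : {set 'I_N * 'I_N}) M D E C :
  spreads (@swap N @: A) B M D E C -> spreads A (@swap N @: B) M D E C.
Proof.
move=> [f [[fl fe] fA fC]]; exists (fun z => swap (f (swap z))); split; first split.
- by move=> z z'; rewrite -(cdist_swap z z') cdist_swap; exact: fl.
- move=> z ez; rewrite -{2}(swapK z) cdist_swap; apply: fe.
  by rewrite edge_cell_swap.
- by move=> z zA; apply: imset_f; apply: fA; apply: imset_f.
- move=> c /imsetP[c' /fC[z' /imsetP[z zA ->] h] ->]; exists z => //.
  by rewrite cdist_swap.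
Qed.

(* Chosen so that [slope * upot] is 1/4-Lipschitz in each variable. *)
Definition slope : R := (4 * (400 * 64))^-1.

Lemma slope_gt0 : 0 < slope.
Proof. by rewrite invr_gt0; lra. Qed.

Lemma slopeK : slope * (4 * (400 * 64)) = 1.
Proof.
have p : 0 < 4 * (400 * 64) :> R by lra.
exact: mulVf (lt0r_neq0 p).
Qed.

Definition incell N (A : {set 'I_N * 'I_N}) (i j : nat) : bool :=
  [exists z in A, (val z.1 == i) && (val z.2 == j)].

Lemma incellE N (A : {set 'I_N * 'I_N}) (z : 'I_N * 'I_N) :
  incell A z.1 z.2 = (z \in A).
Proof.
apply/idP/idP => [/existsP[z' /and3P[z'A /eqP e1 /eqP e2]]|zA].
  suff -> : z = z' by [].
  by case: z z' e1 e2 {z'A} => [a b] [a' b'] /= /val_inj -> /val_inj ->.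
by apply/existsP; exists z; rewrite zA !eqxx.
Qed.

Definition excess m (A : {set 'I_(2 ^ m) * 'I_(2 ^ m)}) (i j : nat) : R :=
  (incell A i j)%:R - #|A|%:R / (2 ^ m)%:R ^+ 2.

Lemma card_cells m (A : {set 'I_(2 ^ m) * 'I_(2 ^ m)}) :
  0 <= (#|A|%:R / (2 ^ m)%:R ^+ 2 : R) <= 1.
Proof.
rewrite divr_ge0 ?exprn_ge0//= ler_pdivrMr ?exprn_gt0 ?pow2_gt0// mul1r.
rewrite -natrX ler_nat (leq_trans (max_card _))// card_prod card_ord.
by rewrite -mulnn.
Qed.

Lemma excess_norm m (A : {set 'I_(2 ^ m) * 'I_(2 ^ m)}) i j : `|excess A i j| <= 1.
Proof.
rewrite /excess ler_norml; have /andP[? ?] := card_cells A.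
by case: incell => /=; apply/andP; split; lra.
Qed.

Lemma sum_incell m (A : {set 'I_(2 ^ m) * 'I_(2 ^ m)}) :
  \sum_(z : 'I_(2 ^ m) * 'I_(2 ^ m)) (incell A z.1 z.2)%:R = #|A|%:R :> R.
Proof.
under eq_bigr do rewrite incellE.
by rewrite -sum1_card natr_sum [RHS]big_mkcond; apply: eq_bigr => z _; case: ifP.
Qed.

Lemma sum_cells_const m (x : R) :
  \sum_(z : 'I_(2 ^ m) * 'I_(2 ^ m)) x = (2 ^ m)%:R ^+ 2 * x.
Proof. by rewrite [LHS]sumr_const card_prod card_ord -[LHS]mulr_natl natrM expr2. Qed.

Lemma sum_excess m (A : {set 'I_(2 ^ m) * 'I_(2 ^ m)}) :
  \sum_(z : 'I_(2 ^ m) * 'I_(2 ^ m)) excess A z.1 z.2 = 0.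
Proof.
have nz : (2 ^ m)%:R ^+ 2 != 0 :> R by rewrite gt_eqF// exprn_gt0// pow2_gt0.
by rewrite /excess sumrB sum_incell sum_cells_const mulrC divfK// subrr.
Qed.

Lemma sum_excess_sqr m (A : {set 'I_(2 ^ m) * 'I_(2 ^ m)}) :
  \sum_(z : 'I_(2 ^ m) * 'I_(2 ^ m)) excess A z.1 z.2 ^+ 2 =
  #|A|%:R * (1 - #|A|%:R / (2 ^ m)%:R ^+ 2).
Proof.
have n0 : (2 ^ m)%:R != 0 :> R by rewrite gt_eqF// pow2_gt0.
set d : R := #|A|%:R / (2 ^ m)%:R ^+ 2.
transitivity (\sum_(z : 'I_(2 ^ m) * 'I_(2 ^ m))
   ((1 - 2 * d) * (incell A z.1 z.2)%:R + d ^+ 2)).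
  apply: eq_bigr => z _; rewrite /excess -/d; case: incell => /=; ring.
rewrite big_split -mulr_sumr sum_incell sum_cells_const /= /d; field.
by rewrite n0.
Qed.

Lemma truncn_near (x : R) : 0 <= x -> (Num.truncn x)%:R <= x < (Num.truncn x)%:R + 1.
Proof. by move=> x0; have := truncn_itv x0; rewrite natr1. Qed.

Lemma horizontal_step m (A : {set 'I_(2 ^ m) * 'I_(2 ^ m)}) :
  \sum_(z : 'I_(2 ^ m) * 'I_(2 ^ m)) excess A z.1 z.2 ^+ 2 <=
  2 * \sum_(z : 'I_(2 ^ m) * 'I_(2 ^ m)) \sum_(k < m) hcoef (excess A) k z.1 z.2 ^+ 2 ->
  exists2 B, spreads A B 2 4 2 3 &
    #|A|%:R + slope / 8 * (#|A|%:R * (1 - #|A|%:R / (2 ^ m)%:R ^+ 2)) <= #|B|%:R.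
Proof.
move=> hV; have g1 := excess_norm A.
have gain := upot_gain g1 hV.
set u := upot m (excess A) in gain.
have N0 : (0 < 2 ^ m)%N by rewrite expn_gt0.
have t0 := slope_gt0; have tK := slopeK.
have tu (x : R) : `|x| <= 400 * 64 -> `|slope * x| <= 1 / 4.
  rewrite normrM gtr0_norm// => /(ler_wpM2l (ltW t0)) /le_trans; apply.
  by rewrite -(ler_pM2r (_ : 0 < 4))//; lra.
(* New abscissa of the left side of cell [i] in row [j]. The ends of the row stay fixed and each
   cell keeps a length between 3/4 and 5/4. *)
pose F j i : R := i%:R + slope * u i j.
have Fstep j i : 3 / 4 <= F j i.+1 - F j i <= 5 / 4.
  have := tu _ (upot_dx_norm m g1 i j); rewrite ler_norml -/u /F -[i.+1%:R]natr1.
  by move=> /andP[? ?]; apply/andP; split; lra.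
have F0 j : F j 0%N = 0.
  by rewrite /F /u (upot_left_right _ _ (dvdn0 _)) mulr0 addr0.
have FN j : F j (2 ^ m)%N = (2 ^ m)%:R.
  by rewrite /F /u (upot_left_right _ _ (dvdnn _)) mulr0 addr0.
have Fmon j i i' : (i <= i')%N -> F j i <= F j i'.
  move=> /subnK <-; elim: (i' - i)%N => // k; rewrite addSn => /le_trans; apply.
  by have /andP[] := Fstep j (k + i)%N; lra.
have F_ge0 j i : 0 <= F j i by rewrite -(F0 j) Fmon.
have Flt j i : (i < 2 ^ m)%N -> F j i < (2 ^ m)%:R.
  move=> h; have := Fmon j _ _ h; rewrite FN; have /andP[] := Fstep j i; lra.
have tlt j (i : 'I_(2 ^ m)) : (Num.truncn (F j i) < 2 ^ m)%N.
  rewrite -(ltr_nat R); apply: le_lt_trans (Flt j i _) => //.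
  by have /andP[] := truncn_near (F_ge0 j i).
pose phi (z : 'I_(2 ^ m) * 'I_(2 ^ m)) := (Ordinal (tlt z.2 z.1), z.2).
(* All cells that the image intervals meet, not just the image of [A] under [phi]: this is where
   cells are gained. *)
pose B : {set 'I_(2 ^ m) * 'I_(2 ^ m)} := [set c : 'I_(2 ^ m) * 'I_(2 ^ m) |
   [exists i : 'I_(2 ^ m),
   [&& incell A i c.2, F c.2 i < c.1%:R + 1 & c.1%:R < F c.2 i.+1]]].
exists B; first (exists phi; split; first split).
- move=> z z'.
  have [tl tr] := andP (truncn_near (F_ge0 z.2 z.1)).
  have [tl' tr'] := andP (truncn_near (F_ge0 z'.2 z'.1)).
  have h1 := lipschitz_nat (fun i => upot_dx_norm m g1 i z.2) z.1 z'.1.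
  have h2 := lipschitz_nat (fun j => upot_dy_norm m g1 z'.1 j) z.2 z'.2.
  have h3 : `|slope * (u z.1 z.2 - u z'.1 z'.2)| <= cdist z z' / 4.
    rewrite normrM gtr0_norm//.
    have : `|u z.1 z.2 - u z'.1 z'.2| <= 400 * 64 * cdist z z'.
      have := ler_normD (u z.1 z.2 - u z'.1 z.2) (u z'.1 z.2 - u z'.1 z'.2).
      rewrite addrA subrK; move: h1 h2; rewrite -/u /cdist; lra.
    move=> /(ler_wpM2l (ltW t0)) /le_trans; apply.
    have -> : slope * (400 * 64 * cdist z z') = slope * (4 * (400 * 64)) * (cdist z z' / 4).
      by field.
    by rewrite tK mul1r.
  move: h3 tl tr tl' tr'; rewrite /F mulrBr => h3 tl tr tl' tr'.
  rewrite /phi /cdist /= in h3 *.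
  move: ((Num.truncn (z.1%:R + slope * u z.1 z.2))%:R)
    ((Num.truncn (z'.1%:R + slope * u z'.1 z'.2))%:R) tl tr tl' tr' => T T' tl tr tl' tr'.
  move: (slope * u z.1 z.2) (slope * u z'.1 z'.2) h3 tl tr tl' tr' => s s'.
  have b0 : 0 <= `|z.2%:R - z'.2%:R| :> R by [].
  have a0 : 0 <= `|z.1%:R - z'.1%:R| :> R by [].
  move: (`|z.2%:R - z'.2%:R|) b0 => b b0; move: (z.1%:R) (z'.1%:R) a0 => x x' a0.
  move=> h3 tl tr tl' tr'.
  have h4 : `|(T - T') - (x - x')| <= (`|x - x'| + b) / 4 + 1.
    move: h3; rewrite !ler_norml => /andP[? ?]; apply/andP; split; lra.
  have := ler_normD (x - x') ((T - T') - (x - x')).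
  have := ler_normB (T - T') ((T - T') - (x - x')).
  have -> : x - x' + (T - T' - (x - x')) = T - T' by ring.
  have -> : T - T' - (T - T' - (x - x')) = x - x' by ring.
  by split; lra.
- move=> z ez; rewrite /cdist /= subrr normr0 addr0.
  have [tl tr] := andP (truncn_near (F_ge0 z.2 z.1)).
  suff : `|slope * u z.1 z.2| <= 1.
    move: tl tr; rewrite {2 3}/F !ler_norml => ? ? /andP[? ?]; apply/andP; split; lra.
  (* On the sides of the square [u] is at most 64 in absolute value; cells at the right and at the
     top are one step away from their side. *)
  have sm : `|u z.1 z.2| <= 400 * 64 + 64.
    case/or4P: ez => [/eqP ->|/eqP e|/eqP ->|/eqP e].
    + by rewrite /u (upot_left_right _ _ (dvdn0 _)) normr0; lra.
    + have := upot_dx_norm m g1 z.1 z.2; rewrite -/u e.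
      rewrite /u (upot_left_right _ _ (dvdnn _)) sub0r normrN; lra.
    + have := @upot_bottom_top R m _ g1 z.1 0%N (dvdn0 _); rewrite -/u; lra.
    + have := upot_dy_norm m g1 z.1 z.2; rewrite -/u e.
      have := @upot_bottom_top R m _ g1 z.1 _ (dvdnn (2 ^ m)); rewrite -/u.
      have := ler_normB (u z.1 (2 ^ m)%N) (u z.1 (2 ^ m)%N - u z.1 z.2).
      by rewrite opprB addrC subrK; lra.
  rewrite normrM gtr0_norm//; move: sm => /(ler_wpM2l (ltW t0)) /le_trans; apply.
  by lra.
- move=> z zA; rewrite inE; apply/existsP; exists z.1.
  have [tl tr] := andP (truncn_near (F_ge0 z.2 z.1)).
  rewrite incellE zA /= tr /=.
  by have /andP[] := Fstep z.2 z.1; lra.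
- move=> c; rewrite inE => /existsP[i /and3P[iA h1 h2]].
  exists (i, c.2); first by rewrite -incellE.
  rewrite /cdist /= subrr normr0 addr0.
  have [tl tr] := andP (truncn_near (F_ge0 c.2 i)).
  by have /andP[? ?] := Fstep c.2 i; rewrite ler_norml; apply/andP; split; lra.
have cB : \sum_(j < 2 ^ m) \sum_(i < 2 ^ m | incell A i j) (F j i.+1 - F j i) <= #|B|%:R.
  rewrite -(sum_incell B) (sum_cell _ (fun i j => (incell B i j)%:R)) exchange_big.
  apply: ler_sum => j _.
  apply: (le_trans (@hit_cells_ge R (2 ^ m) (F j) (fun i => incell A i j) _ _ _)) => //.
    by move=> i; apply: Fmon.
  apply: ler_sum => i _; rewrite (incellE B (i, j)) inE /=.
  by rewrite ler_nat; case: existsP.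
apply: le_trans cB.
under [leRHS]eq_bigr do rewrite big_mkcond; rewrite exchange_big /=.
rewrite -(sum_cell _ (fun i j => if incell A i j then F j i.+1 - F j i else 0)).
have -> : \sum_(z : 'I_(2 ^ m) * 'I_(2 ^ m))
    (if incell A z.1 z.2 then F z.2 z.1.+1 - F z.2 z.1 else 0) =
  #|A|%:R + slope * \sum_(z : 'I_(2 ^ m) * 'I_(2 ^ m))
     excess A z.1 z.2 * (u z.1.+1 z.2 - u z.1 z.2).
  (* [u] vanishes at both ends of each row, so subtracting the density from the indicator of [A]
     does not change the total length. *)
  have tel : \sum_(z : 'I_(2 ^ m) * 'I_(2 ^ m)) (u z.1.+1 z.2 - u z.1 z.2) = 0.
    rewrite (sum_cell _ (fun i j => u i.+1 j - u i j)) exchange_big big1// => j _.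
    rewrite -(big_mkord xpredT (fun i => u i.+1 j - u i j)).
    rewrite (telescope_sumr (fun i => u i j))// /u.
    by rewrite !upot_left_right ?subrr.
  under [X in slope * X]eq_bigr do rewrite /excess mulrBl.
  rewrite sumrB -mulr_sumr tel mulr0 subr0 -sum_incell mulr_sumr -big_split.
  by apply: eq_bigr => z _ /=; rewrite /F -[z.1.+1%:R]natr1; case: incell => /=; ring.
rewrite lerD2l; move: gain; rewrite sum_excess_sqr => /(ler_wpM2l (ltW t0)).
lra.
Qed.

Lemma spread_step m (A : {set 'I_(2 ^ m) * 'I_(2 ^ m)}) :
  exists2 B, spreads A B 2 4 2 3 &
    #|A|%:R + slope / 8 * (#|A|%:R * (1 - #|A|%:R / (2 ^ m)%:R ^+ 2)) <= #|B|%:R.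
Proof.
have := sum_excess A; rewrite (sum_cell _ (excess A)) => /variance_le.
set V := (X in X <= _); set H := (X in _ <= X + _); set W := (X in _ <= _ + X) => hV.
case: (lerP V (2 * H)) => [/horizontal_step//|hH].
pose A' := @swap (2 ^ m) @: A.
have cA' : #|A'| = #|A| by rewrite card_imset//; exact: inv_inj (@swapK _).
have eA' i j : excess A' i j = excess A j i.
  rewrite /excess cA'; congr ((nat_of_bool _)%:R - _); apply/existsP/existsP.
    move=> [z /and3P[/imsetP[z' z'A ->] h1 h2]]; exists z'.
    by rewrite z'A h1 andbC h2.
  move=> [z /and3P[zA h1 h2]]; exists (swap z).
  by rewrite imset_f//= h1 h2.
have hc k i j : hcoef (excess A') k i j = hcoef (fun x y => excess A y x) k i j.
  rewrite /hcoef /hdiff.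
  suff E x y : block_avg (excess A') k x y = block_avg (fun x y => excess A y x) k x y.
    by rewrite !E.
  by elim: k x y => [|k IH] x y //=; rewrite !IH.
have [] := @horizontal_step m A'.
  rewrite !sum_excess_sqr cA' -sum_excess_sqr -/V.
  suff -> : \sum_(z : 'I_(2 ^ m) * 'I_(2 ^ m)) \sum_(k < m) hcoef (excess A') k z.1 z.2 ^+ 2 = W.
    lra.
  by apply: eq_bigr => z _; apply: eq_bigr => k _; rewrite hc.
move=> B sB cB; exists (@swap (2 ^ m) @: B); first exact: spreads_swap.
rewrite card_imset; last exact: inv_inj (@swapK _).
by rewrite cA' in cB.
Qed.

(** As long as the density lies between [delta] and [1 - eps], a step adds at least
    [slope / 8 * delta * eps] to it. The constants depend on the number of steps but not on [m]. *)
Lemma spread_iter (eps delta : R) (J : nat) : 0 < eps -> 0 < delta ->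
  exists M D E C : R, [/\ 0 <= M, 0 <= D & 
  forall m (A : {set 'I_(2 ^ m) * 'I_(2 ^ m)}),
    delta * (2 ^ m)%:R ^+ 2 <= #|A|%:R ->
    exists2 B, spreads A B M D E C &
      Num.min (1 - eps) (delta + J%:R * (slope / 8 * delta * eps)) * (2 ^ m)%:R ^+ 2
      <= #|B|%:R].
Proof.
move=> e0 d0; elim: J => [|J [M [D [E [C [M0 D0 IH]]]]]].
  exists 1, 0, 0, 0; split => // m A hA; exists A.
    exists id; split => //; first split => [z z'|z _].
    - by rewrite mul1r addr0.
    - by rewrite /cdist !subrr normr0 addr0.
    - by move=> c cA; exists c => //; rewrite /cdist !subrr normr0 addr0.
  apply: le_trans hA; rewrite mul0r addr0 ler_wpM2r ?exprn_ge0//.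
  by rewrite ge_min lexx orbT.
exists (M * 2), (2 * D + 4 + M * 4 + D), (2 * E + 4 + 2), (3 + 2 * C + 4).
split; [by rewrite mulr_ge0| by rewrite !addr_ge0// mulr_ge0|].
move=> m A hA; have [B sB cB] := IH m A hA.
have [B' sB' cB'] := spread_step B; exists B'.
  exact: spreads_comp sB sB'.
apply: le_trans cB'.
have n0 : 0 < (2 ^ m)%:R ^+ 2 :> R by rewrite exprn_gt0// pow2_gt0.
have t0 := slope_gt0.
have s0 : 0 <= slope / 8 by rewrite divr_ge0// ltW.
have /andP[x0 x1] := card_cells B.
set x := _ / _ in x0 x1 *.
have Bx : #|B|%:R = x * (2 ^ m)%:R ^+ 2 by rewrite /x divfK// gt_eqF.
rewrite Bx.
have -> : x * (2 ^ m)%:R ^+ 2 + slope / 8 * (x * (2 ^ m)%:R ^+ 2 * (1 - x)) =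
  (x + slope / 8 * (x * (1 - x))) * (2 ^ m)%:R ^+ 2 by ring.
rewrite ler_pM2r//.
move: cB; rewrite Bx ler_pM2r// !ge_min => /orP[h|h].
  apply/orP; left; apply: le_trans h _; rewrite lerDl.
  by apply: mulr_ge0 => //; apply: mulr_ge0; rewrite ?subr_ge0.
case: (lerP (1 - eps) x) => hx.
  apply/orP; left; apply: le_trans hx _; rewrite lerDl.
  by apply: mulr_ge0 => //; apply: mulr_ge0; rewrite ?subr_ge0.
have dx : delta <= x.
  apply: le_trans h; rewrite lerDl mulr_ge0//.
  by apply: mulr_ge0 (ltW e0); apply: mulr_ge0 (ltW d0).
have ex : eps <= 1 - x by lra.
have := ler_wpM2l s0 (ler_pM (ltW d0) (ltW e0) dx ex).
by apply: contraTT => /norP[_]; rewrite -!ltNge -[J.+1%:R]natr1; lra.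
Qed.

Theorem spread_dense (eps delta : R) : 0 < eps -> 0 < delta ->
  exists M D E C : R, [/\ 0 <= M, 0 <= D & 
  forall m (A : {set 'I_(2 ^ m) * 'I_(2 ^ m)}),
    delta * (2 ^ m)%:R ^+ 2 <= #|A|%:R ->
    exists2 B, spreads A B M D E C & (1 - eps) * (2 ^ m)%:R ^+ 2 <= #|B|%:R].
Proof.
move=> e0 d0; have t0 := slope_gt0.
have s0 : 0 < slope / 8 * delta * eps by rewrite mulr_gt0// mulr_gt0// divr_gt0.
(* After [J.+1] steps the guaranteed gain is at least 1, so the minimum in [spread_iter] is
   [1 - eps]. *)
pose J := Num.truncn (1 / (slope / 8 * delta * eps)).
have hJ : 1 <= J.+1%:R * (slope / 8 * delta * eps).
  rewrite -ler_pdivrMr// -[J.+1%:R]natr1; apply/ltW.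
  by have /andP[] := truncn_near (divr_ge0 ler01 (ltW s0)).
have [M [D [E [C [M0 D0 H]]]]] := spread_iter J.+1 e0 d0.
exists M, D, E, C; split => // m A hA; have [B sB cB] := H m A hA.
exists B => //; apply: le_trans cB; rewrite ler_wpM2r ?exprn_ge0//.
by rewrite le_min lexx; lra.
Qed.

End CellMaps.

(** * Poisson points in disjoint boxes *)

Local Open Scope classical_set_scope.
Local Open Scope ring_scope.

Section PoissonBoxes.
Variable R : realType.
Variable I : finType.
Variable box : I -> set (R * R).
Variable a : R.
Hypothesis mbox : forall i, measurable (box i).
Hypothesis box_area : forall i, leb2 (box i) = a%:E.
Hypothesis box_disj : forall i j x, box i x -> box j x -> i = j.
Hypothesis a_ge0 : 0 <= a.

Definition dec (v : I -> nat) (i j : I) : nat := if j == i then (v j).-1 else v j.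

(* Tuples with exactly [v i] points in each [box i] and none outside the boxes. *)
Fixpoint occ (k : nat) : (I -> nat) -> set (k.-tuple (R * R)) :=
  match k as k0 return (I -> nat) -> set (k0.-tuple (R * R)) with
  | 0%N => fun v => [set t | forall i, v i = 0%N]
  | k'.+1 => fun v => [set t | exists i, [/\ box i (thead t), (0 < v i)%N &
      occ (dec v i) [tuple of behead t]]]
  end.

Lemma occ_boxes k v (t : k.-tuple (R * R)) : occ v t ->
  (forall x, x \in tval t -> exists2 i, (0 < v i)%N & box i x) /\
  (forall i, (0 < v i)%N -> exists2 x, x \in tval t & box i x).
Proof.
elim: k v t => [|k IH] v t /=.
  by rewrite (tuple0 t) => v0; split => // i; rewrite v0.
case: (tupleP t) => y u; rewrite theadE => -[i [yi vi]].
have -> : [tuple of behead [tuple of y :: u]] = u by exact: val_inj.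
move=> /IH[H1 H2]; split => [x|j vj].
  rewrite inE => /predU1P[->|/H1[j vj xj]]; first by exists i.
  by exists j => //; move: vj; rewrite /dec; case: eqP => // ->.
have [->|ji] := eqVneq j i; first by exists y => //; rewrite inE eqxx.
have [|x xu xj] := H2 j; first by rewrite /dec (negbTE ji).
by exists x => //; rewrite inE xu orbT.
Qed.

Lemma measurable_occ k v : measurable (@occ k v).
Proof.
elim: k v => [|k IH] v /=.
  case: (pselect (forall i, v i = 0%N)) => h.
    by rewrite (_ : [set _ | _] = setT)//; apply/seteqP; split.
  by rewrite (_ : [set _ | _] = set0)//; apply/seteqP; split.
pose S i : set (k.+1.-tuple (R * R)) := if (0 < v i)%N then
   ((@thead k (R * R)) @^-1` box i) `&`
   ((fun t : k.+1.-tuple (R * R) => [tuple of behead t]) @^-1` occ (dec v i)) else set0.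
rewrite (_ : [set _ | _] = \bigcup_(i in [set: I]) S i); last first.
  apply/seteqP; split => [t [i [h1 h2 h3]]|t [i _]].
    by exists i => //; rewrite /S h2.
  by rewrite /S; case: ifP => // h2 [h1 h3]; exists i.
apply: fin_bigcup_measurable => [|i _]; first exact: finite_finset.
rewrite /S; case: ifP => _ //; apply: measurableI.
  rewrite -[_ @^-1` _]setTI.
  exact: (@measurable_tnth _ _ k.+1 ord0 measurableT _ (mbox i)).
rewrite -[_ @^-1` _]setTI.
exact: (@measurable_behead _ _ k measurableT _ (IH (dec v i))).
Qed.

Lemma tleb_set0 k : @tleb R k set0 = 0%E.
Proof.
elim: k => [|k IH] /=; first by rewrite asboolF.
by under eq_integral do rewrite IH; rewrite integral0.
Qed.

Lemma tleb_ge0 k A : (0 <= @tleb R k A)%E.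
Proof.
elim: k A => [|k IH] A /=; first by case: ifP.
by apply: integral_ge0 => x _; exact: IH.
Qed.

(** Multinomial formula, by conditioning on the box of the first point: box [i] contributes a share
    proportional to [v i], and the [v i] add up to the number of points, which completes the
    factorial. *)
Lemma tleb_occ k v : (\sum_i v i = k)%N ->
  tleb (@occ k v) = ((k`!)%:R * a ^+ k / (\prod_i (v i)`!)%:R)%:E.
Proof.
elim: k v => [|k IH] v sv.
  have v0 i : v i = 0%N by move/eqP: sv; rewrite sum_nat_eq0 => /forallP/(_ i)/eqP.
  rewrite /= asboolT// expr0 mulr1 big1 ?divr1// => i _; by rewrite v0.
pose w i : R := if (0 < v i)%N then
   (k`!)%:R * a ^+ k / (\prod_j (dec v i j)`!)%:R else 0.
have w0 i : 0 <= w i.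
  by rewrite /w; case: ifP => _ //; rewrite divr_ge0// mulr_ge0// exprn_ge0.
have E x : tleb [set t : k.-tuple (R * R) | occ v [tuple of x :: t]] =
    (\sum_i (w i * \1_(box i) x)%:E)%E.
  have tE (t : k.-tuple (R * R)) : [tuple of behead [tuple of x :: t]] = t by exact: val_inj.
  case: (pselect (exists i, box i x)) => [[i xi]|nx].
    rewrite (bigD1 i)//= big1 ?adde0 => [|j ji]; last first.
      rewrite indicE memNset ?mulr0// => xj.
      by move/eqP: ji; apply; exact: box_disj xj xi.
    rewrite indicE mem_set// mulr1 /w; case: ifP => vi.
      rewrite -IH; last first.
        rewrite (bigD1 i)//= /dec eqxx (eq_bigr v) => [|j /negbTE ->//].
        by move: sv; rewrite (bigD1 i)//=; lia.
      congr tleb; apply/seteqP; split => t /=; rewrite theadE tE; last by exists i.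
      by move=> [j [xj _]]; rewrite (box_disj xi xj).
    transitivity (@tleb R k set0); last exact: tleb_set0.
    congr tleb; apply/seteqP; split => t //=.
    rewrite theadE tE => -[j [xj vj]].
    by rewrite (box_disj xi xj) vj in vi.
  rewrite big1 => [|i _]; last first.
    by rewrite indicE memNset ?mulr0// => xi; apply: nx; exists i.
  transitivity (@tleb R k set0); last exact: tleb_set0.
    congr tleb; apply/seteqP; split => t //=.
  by rewrite theadE => -[j [xj _]]; case: nx; exists j.
rewrite [LHS]/=.
under eq_integral do rewrite E.
rewrite /leb2 ge0_integral_sum//; first last.
- by move=> i x _; rewrite lee_fin mulr_ge0.
- move=> i; apply/measurable_EFinP; apply: measurable_funM.
    exact: measurable_cst.
  by apply/measurable_indicP; exact: mbox.
transitivity (\sum_i (w i * a)%:E)%E.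
  apply: eq_bigr => i _; under eq_integral do rewrite EFinM.
  rewrite ge0_integralZl//; first last.
  - by rewrite lee_fin.
  - by apply/measurable_EFinP; apply/measurable_indicP; exact: mbox.
  rewrite integral_indic; [|exact: measurableT|exact: mbox].
  rewrite EFinM; congr (_ * _)%E; rewrite -(box_area i) /leb2.
  by congr (_ _); exact: setIT.
rewrite sumEFin; congr (_%:E).
transitivity (\sum_i (v i)%:R * ((k`!)%:R * a ^+ k.+1 / (\prod_i (v i)`!)%:R)).
  apply: eq_bigr => i _; rewrite /w; case: ifP => [vi|/negbT]; last first.
    by rewrite -leqNgt leqn0 => /eqP ->; rewrite !mul0r.
  have P0 : (\prod_(j | j != i) (v j)`!)%:R != 0 :> R.
    by rewrite pnatr_eq0 -lt0n prodn_gt0// => j; exact: fact_gt0.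
  have f0 : ((v i).-1)`!%:R != 0 :> R by rewrite pnatr_eq0 -lt0n fact_gt0.
  have v0 : (v i)%:R != 0 :> R by rewrite pnatr_eq0 -lt0n.
  rewrite !(bigD1 i (P := predT))//= /dec eqxx.
  rewrite (eq_bigr (fun j => (v j)`!)) => [|j /negbTE ->//].
  rewrite -[in (v i)`!](prednK vi) factS (prednK vi) !natrM exprSr.
  by field; rewrite P0 f0 v0.
rewrite -mulr_suml -natr_sum sv factS natrM.
by rewrite !mulrA.
Qed.

(** One term of the Poisson series is enough: [r * #|A|] points, exactly [r] in each box of [A]. Its
    factorial cancels the one in [tleb_occ]. *)
Lemma poisson_prob_ge_boxes n (A : {set I}) (r : nat) (E : seq (R * R) -> Prop) p :
  (0 < r)%N ->
  (forall i x, i \in A -> box i x -> inbox n x) ->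
  (forall ys, (forall y, y \in ys -> exists2 i, i \in A & box i y) ->
     (forall i, i \in A -> exists2 y, y \in ys & box i y) -> E ys) ->
  p <= expR (- (n%:R ^+ 2)) * (a ^+ r / (r`!)%:R) ^+ #|A| ->
  poisson_prob_ge n E p.
Proof.
move=> r0 Ain AE pE.
pose v i := if i \in A then r else 0%N.
have vpos i : (0 < v i)%N = (i \in A) by rewrite /v; case: ifP.
exists (fun k => @occ k v); split => [k|].
  split; first exact: measurable_occ.
  move=> t /occ_boxes[H1 H2]; split => [x|].
    by have [i] := H1 _ (mem_tnth x t); rewrite vpos => iA /(Ain _ _ iA).
  apply: AE => [y /H1[i]|i]; first by rewrite vpos; exists i.
  by rewrite -vpos => /H2.
set u := (X in (_ <= X)%E).
have sv : (\sum_i v i = r * #|A|)%N.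
  by rewrite /v -big_mkcond sum_nat_const mulnC.
pose k := (r * #|A|)%N.
have u0 j : (0 <= (expR (- (n%:R ^+ 2)) / (j`!)%:R)%:E * tleb (@occ j v))%E.
  by rewrite mule_ge0 ?tleb_ge0// lee_fin divr_ge0// expR_ge0.
apply: le_trans (nneseries_lim_ge k.+1 (fun j _ _ => u0 j)).
rewrite big_nat_recr//=; apply: (@le_trans _ _ (0 + (expR (- (n%:R ^+ 2)) / (k`!)%:R)%:E * tleb (@occ k v))%E); last first.
  by apply: leeD => //; apply: sume_ge0.
rewrite add0e tleb_occ// -EFinM lee_fin.
apply: (le_trans pE); rewrite le_eqVlt; apply/orP; left; apply/eqP.
have -> : (\prod_i (v i)`! = r`! ^ #|A|)%N.
  rewrite -prod_nat_const [RHS]big_mkcond; apply: eq_bigr => i _.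
  by rewrite /v; case: ifP.
have f0 : r`!%:R != 0 :> R by rewrite pnatr_eq0 -lt0n fact_gt0.
have k0 : k`!%:R != 0 :> R by rewrite pnatr_eq0 -lt0n fact_gt0.
rewrite exprMn exprVn -exprM natrX -/k; field.
by rewrite k0 expf_neq0.
Qed.

End PoissonBoxes.

(** * An explicit form of Stirling's bound *)

Section Stirling.
Variable R : realType.

(** The inductive step multiplies the left side by [e (r+1)], and [e (r+1)^(r+2) <= (r+2)^(r+2)] is
    the inequality [1 - x <= exp(-x)] at [x = 1/(r+2)]. *)
Lemma fact_expR_le r : (r`!)%:R * expR r%:R <= (r.+1 ^ r.+1)%:R :> R.
Proof.
elim: r => [|r IH]; first by rewrite expR0 mulr1.
have r2 : 0 < r.+2%:R :> R by [].
have E : expR 1 * (r.+1)%:R ^+ r.+2 <= (r.+2)%:R ^+ r.+2 :> R.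
  have H : (r.+1)%:R <= expR (- (r.+2)%:R^-1) * (r.+2)%:R :> R.
    have := @expR_ge1Dx R (- (r.+2)%:R^-1) => /(ler_wpM2r (ltW r2)).
    rewrite mulrDl mul1r mulNr mulVf ?gt_eqF//; apply: le_trans.
    by rewrite -[r.+2%:R]natr1 addrK.
  have {}H : (r.+1)%:R ^+ r.+2 <= (expR (- (r.+2)%:R^-1) * (r.+2)%:R) ^+ r.+2 :> R.
    by rewrite lerXn2r ?nnegrE ?mulr_ge0 ?expR_ge0.
  move: H; rewrite exprMn -expRM_natl mulrN divff ?gt_eqF// => H.
  apply: le_trans (ler_wpM2l (expR_ge0 1) H) _.
  by rewrite mulrA -expRD subrr expR0 mul1r.
rewrite factS natrM -[X in expR X]natr1 expRD.
move: IH; rewrite !natrX => IH.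
apply: le_trans E; rewrite exprS.
have := ler_wpM2l (mulr_ge0 (ler0n R r.+1) (expR_ge0 1)) IH.
by rewrite (_ : _ * (r`!%:R * expR r%:R) = r.+1%:R * r`!%:R * (expR r%:R * expR 1)); [|ring];
  rewrite (_ : r.+1%:R * expR 1 * _ = expR 1 * (r.+1%:R * r.+1%:R ^+ r.+1)); [|ring].
Qed.

Lemma pow_fact_ge r : (0 < r)%N ->
  expR (r%:R - 1) / r.+1%:R <= r%:R ^+ r / (r`!)%:R :> R.
Proof.
move=> r0; have R0 : 0 < r%:R :> R by rewrite ltr0n.
have f0 : 0 < r`!%:R :> R by rewrite ltr0n fact_gt0.
have H : (r.+1)%:R ^+ r <= expR 1 * r%:R ^+ r :> R.
  have h : (r.+1)%:R <= expR r%:R^-1 * r%:R :> R.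
    have := @expR_ge1Dx R r%:R^-1 => /(ler_wpM2r (ltW R0)).
    by rewrite mulrDl mul1r mulVf ?gt_eqF// natr1.
  have {}h : (r.+1)%:R ^+ r <= (expR r%:R^-1 * r%:R) ^+ r :> R.
    by rewrite lerXn2r ?nnegrE ?mulr_ge0 ?expR_ge0.
  by move: h; rewrite exprMn -expRM_natl divff ?gt_eqF.
rewrite ler_pdivrMr// mulrAC ler_pdivlMr//.
have := fact_expR_le r; rewrite natrX exprSr expRD expRN => F.
have e1 : 0 < expR 1 :> R := expR_gt0 1.
rewrite -(ler_pM2l e1).
have -> : expR 1 * (expR r%:R / expR 1 * r`!%:R) = r`!%:R * expR r%:R :> R.
  by field; rewrite gt_eqF.
apply: (le_trans F); rewrite mulrA ler_wpM2r//.
Qed.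

End Stirling.

(** * The grid on [0, n]^2 *)

Section Grid.
Variable R : realType.

Definition l1 (p q : R * R) : R := `|p.1 - q.1| + `|p.2 - q.2|.

Lemma l1_tri (x y z : R * R) : l1 x z <= l1 x y + l1 y z.
Proof.
rewrite /l1; have := ler_distD y.1 x.1 z.1.
by have := ler_distD y.2 x.2 z.2; lra.
Qed.

Lemma l1C (x y : R * R) : l1 x y = l1 y x.
Proof. by rewrite /l1 distrC [X in _ + X]distrC. Qed.

Lemma edist_le_l1 (p q : R * R) : edist p q <= l1 p q.
Proof.
have l0 : 0 <= l1 p q by exact: addr_ge0.
rewrite /edist -[leRHS]ger0_norm// -sqrtr_sqr; apply: ler_wsqrtr.
rewrite /l1 -(real_normK (num_real (p.1 - q.1))) -(real_normK (num_real (p.2 - q.2))).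
have := mulr_ge0 (normr_ge0 (p.1 - q.1)) (normr_ge0 (p.2 - q.2)); nra.
Qed.

Lemma l1_le_edist (p q : R * R) : l1 p q <= 2 * edist p q.
Proof.
rewrite /l1 /edist.
have h1 : `|p.1 - q.1| <= Num.sqrt ((p.1 - q.1) ^+ 2 + (p.2 - q.2) ^+ 2).
  by rewrite -sqrtr_sqr ler_wsqrtr// lerDl sqr_ge0.
have h2 : `|p.2 - q.2| <= Num.sqrt ((p.1 - q.1) ^+ 2 + (p.2 - q.2) ^+ 2).
  by rewrite -sqrtr_sqr ler_wsqrtr// lerDr sqr_ge0.
by lra.
Qed.

Lemma grid_scale (s n : nat) : (0 < s)%N -> (s <= n)%N ->
  exists m, (s * 2 ^ m <= n < s * 2 ^ m.+1)%N.
Proof.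
move=> s0 sn; exists (trunc_log 2 (n %/ s)).
have q0 : (0 < n %/ s)%N by rewrite divn_gt0.
apply/andP; split.
  by rewrite mulnC -leq_divRL// trunc_logP.
by rewrite mulnC -ltn_divLR// trunc_log_ltn.
Qed.

Variables (m n : nat) (h : R).
Hypothesis h_gt0 : 0 < h.
Hypothesis hn : h * (2 ^ m)%:R = n%:R.
Local Notation cell := ('I_(2 ^ m) * 'I_(2 ^ m))%type.

Lemma coord_proof (t : R) : (minn (Num.truncn (t / h)) (2 ^ m).-1 < 2 ^ m)%N.
Proof. by rewrite gtn_min prednK ?expn_gt0// leqnn orbT. Qed.

(** The minimum with [(2 ^ m).-1] puts the far side [t = n] into the last cell. *)
Definition coord (t : R) : 'I_(2 ^ m) := Ordinal (coord_proof t).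
Definition cellof (p : R * R) : cell := (coord p.1, coord p.2).
Definition corner (z : cell) : R * R := (z.1%:R * h, z.2%:R * h).
Definition cbox (z : cell) : set (R * R) :=
  `[z.1%:R * h, (z.1%:R + 1) * h[%classic `*` `[z.2%:R * h, (z.2%:R + 1) * h[%classic.

Lemma coordP t : 0 <= t <= n%:R ->
  (coord t)%:R * h <= t <= ((coord t)%:R + 1) * h.
Proof.
move=> /andP[t0 tn].
have th0 : 0 <= t / h by rewrite divr_ge0// ltW.
have /andP[k1 k2] := truncn_near th0.
rewrite -(ler_pdivlMr _ _ h_gt0) -(ler_pdivrMr _ _ h_gt0) /coord /=.
case: (leqP (Num.truncn (t / h)) (2 ^ m).-1) => hk.
  by rewrite k1 ltW.
have thN : t / h <= (2 ^ m)%:R by rewrite ler_pdivrMr// mulrC hn.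
rewrite natr1 prednK ?expn_gt0// thN andbT.
by apply: le_trans k1; rewrite ler_nat ltnW.
Qed.

Lemma edge_cellof p : bdry n p -> edge_cell (cellof p).
Proof.
have n0 : (0 < 2 ^ m)%N by rewrite expn_gt0.
have c0 : coord 0 = 0%N :> nat by rewrite /= mul0r truncn0 min0n.
have cn : ((coord n%:R).+1 = 2 ^ m)%N.
  rewrite /= -hn mulrC mulKf ?gt_eqF// natrK (minn_idPr _) ?leq_pred//.
  by rewrite prednK.
move=> [_ e]; rewrite /edge_cell /cellof.
case: e => [->|[->|[->|->]]]; first by rewrite c0 eqxx.
- by rewrite cn eqxx orbT.
- by rewrite c0 eqxx !orbT.
- by rewrite cn eqxx !orbT.
Qed.

Lemma near_corner (p : R * R) : inbox n p -> l1 p (corner (cellof p)) <= 2 * h.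
Proof.
move=> [/coordP/andP[a b] /coordP/andP[c d]]; rewrite /l1 /corner /=.
have e1 : `|p.1 - (coord p.1)%:R * h| <= h.
  by rewrite ger0_norm ?subr_ge0//; lra.
have e2 : `|p.2 - (coord p.2)%:R * h| <= h.
  by rewrite ger0_norm ?subr_ge0//; lra.
by move: e1 e2; rewrite /=; lra.
Qed.

Lemma cbox_near (z : cell) p : cbox z p -> l1 p (corner z) <= 2 * h.
Proof.
move=> [] /=; rewrite !in_itv /= => /andP[a b] /andP[c d].
rewrite /l1 /= !ger0_norm ?subr_ge0//.
by move: a b c d; lra.
Qed.

Lemma cbox_inbox (z : cell) p : cbox z p -> inbox n p.
Proof.
have B (i : 'I_(2 ^ m)) (x : R) : x \in `[i%:R * h, (i%:R + 1) * h[ -> 0 <= x <= n%:R.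
  rewrite in_itv /= => /andP[a b].
  have i0 : 0 <= i%:R * h by rewrite mulr_ge0// ltW.
  have iN : (i%:R + 1) * h <= n%:R.
    by rewrite -hn mulrC ler_wpM2l ?(ltW h_gt0)// natr1 ler_nat.
  by rewrite (le_trans i0 a) (le_trans (ltW b) iN).
by move=> [] /= /B a /B b; split.
Qed.

Lemma cbox_disj (z z' : cell) p : cbox z p -> cbox z' p -> z = z'.
Proof.
have B (i i' : 'I_(2 ^ m)) (x : R) : x \in `[i%:R * h, (i%:R + 1) * h[ ->
    x \in `[i'%:R * h, (i'%:R + 1) * h[ -> (i <= i')%N.
  rewrite !in_itv /= => /andP[a _] /andP[_ b].
  have := le_lt_trans a b; rewrite ltr_pM2r// natr1 ltr_nat ltnS//.
case: z z' => [i j] [i' j'] [] /= a b [] /= c d.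
congr (_, _); apply/val_inj/eqP; rewrite eqn_leq.
  by rewrite (B _ _ _ a c) (B _ _ _ c a).
by rewrite (B _ _ _ b d) (B _ _ _ d b).
Qed.

Lemma measurable_cbox (z : cell) : measurable (cbox z).
Proof. by apply: measurableX; exact: measurable_itv. Qed.

Lemma leb2_cbox (z : cell) : leb2 (cbox z) = (h ^+ 2)%:E.
Proof.
have L (x : R) : lebesgue_measure (`[x * h, (x + 1) * h[%classic : set R) = h%:E.
  rewrite lebesgue_measure_itv /= lte_fin ltr_pM2r// ltrDl ltr01.
  by rewrite -EFinB; congr (_%:E); ring.
rewrite /leb2 /cbox product_measure1E; [|exact: measurable_itv|exact: measurable_itv].
transitivity (h%:E * h%:E)%E; last by rewrite -EFinM expr2.
by congr (_ * _)%E; exact: L.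
Qed.

Lemma corner_dist (z z' : cell) : l1 (corner z) (corner z') = h * cdist R z z'.
Proof.
rewrite /l1 /corner /cdist /= -!mulrBl !normrM (gtr0_norm h_gt0).
by rewrite mulrDr mulrC [X in _ + X]mulrC.
Qed.

(** The margin 4 lets [card_occupied] attach a unit square to the cell of its lower left corner. A
    point of X on a common side belongs to several squares and could not tell them apart. *)
Definition occupied (pts : seq (R * R)) : {set cell} :=
  [set z | `[< exists p, [/\ p \in pts, inbox n p & cdist R z (cellof p) <= 4] >]]%SET.

Lemma occupied_cellof pts p : p \in pts -> inbox n p -> cellof p \in occupied pts.
Proof.
move=> pp pn; rewrite inE; apply/asboolP; exists p; split => //.
by rewrite /cdist !subrr normr0 addr0.
Qed.

Lemma coord_nat_close (x y : R) : 1 <= h -> 0 <= x <= n%:R -> 0 <= y <= n%:R ->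
  x <= y -> y <= x + 1 -> `|(coord x)%:R - (coord y)%:R| <= 2 :> R.
Proof.
move=> h1 /coordP/andP[a b] /coordP/andP[c d] xy yx.
move: (coord x)%:R (coord y)%:R a b c d => i k a b c d.
rewrite ler_norml; apply/andP; split.
  rewrite -(ler_pM2r h_gt0); lra.
rewrite -(ler_pM2r h_gt0); lra.
Qed.

Lemma eq_coord_mod (j j' : 'I_n) : coord j%:R = coord j'%:R ->
  (j = j' %[mod (Num.truncn h).+1])%N -> j = j'.
Proof.
wlog jj : j j' / (j' <= j)%N => [H|].
  by case: (leqP j' j) => [/H//|/ltnW/H + /esym e1 /esym e2]; move=> /(_ e1 e2).
have B (i : 'I_n) : 0 <= (i%:R : R) <= n%:R by rewrite ler0n ler_nat ltnW.
move=> e /eqP; rewrite eqn_mod_dvd// => dv.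
have := coordP (B j); have := coordP (B j'); rewrite e.
move: (coord _)%:R => i /andP[a b] /andP[c d].
have : (j - j')%:R <= h by rewrite natrB//; lra.
rewrite -truncn_ge_nat ?ltW// -ltnS => lt.
apply/val_inj/eqP; rewrite eqn_leq jj andbT -subn_eq0.
by apply: contraTT dv => ne; rewrite gtnNdvd// lt0n.
Qed.

(** A unit square is determined by the cell of its corner and its two indices modulo [w], since
    indices in one cell differ by at most [h < w]. As [w <= 2 * h], each cell serves at most
    [4 * h ^+ 2] squares. *)
Lemma card_occupied pts : 1 <= h ->
  (kX n pts)%:R <= 4 * h ^+ 2 * #|occupied pts|%:R.
Proof.
move=> h1.
pose S : {set 'I_n * 'I_n} := [set jl : 'I_n * 'I_n |
  has (fun p : R * R => [&& (jl.1)%:R <= p.1, p.1 <= (jl.1)%:R + 1,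
     (jl.2)%:R <= p.2 & p.2 <= (jl.2)%:R + 1]) pts]%SET.
have -> : kX n pts = #|S|.
  by apply: eq_card => jl; rewrite [RHS]inE; apply/idP/idP => [/set_mem|/mem_set].
pose w := (Num.truncn h).+1.
pose f (jl : 'I_n * 'I_n) : cell * ('I_w * 'I_w) :=
  (cellof (jl.1%:R, jl.2%:R), (inord (jl.1 %% w), inord (jl.2 %% w))).
have finj : injective f.
  move=> [j l] [j' l'] [e1 e2] /(congr1 val) + /(congr1 val).
  rewrite /= !inordK ?ltn_pmod// => e3 e4.
  by congr (_, _); apply: eq_coord_mod => //; exact: val_inj.
have sub : (f @: S \subset finset.setX (occupied pts) [set: 'I_w * 'I_w])%SET.
  apply/fintype.subsetP => _ /imsetP[[j l] + ->]; rewrite inE => /hasP[p pp /and4P[/= a b c d]].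
  rewrite !inE andbT; apply/asboolP.
  have jn : j%:R + 1 <= n%:R :> R by rewrite natr1 ler_nat.
  have ln : l%:R + 1 <= n%:R :> R by rewrite natr1 ler_nat.
  have j0 : 0 <= j%:R :> R by [].
  have l0 : 0 <= l%:R :> R by [].
  have p1 : 0 <= p.1 <= n%:R by apply/andP; split; lra.
  have p2 : 0 <= p.2 <= n%:R by apply/andP; split; lra.
  exists p; split => //.
  have J : 0 <= (j%:R : R) <= n%:R by apply/andP; split; lra.
  have L : 0 <= (l%:R : R) <= n%:R by apply/andP; split; lra.
  have := coord_nat_close h1 J p1 a b; have := coord_nat_close h1 L p2 c d.
  by rewrite /cdist /cellof; lra.
have := subset_leq_card sub; rewrite card_imset// cardsX cardsT card_prod !card_ord.
rewrite -(ler_nat R) natrM => /le_trans; apply; rewrite mulrC ler_wpM2r// natrM.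
have wh : w%:R <= 2 * h.
  have /andP[] := truncn_near (ltW h_gt0); rewrite /w -natr1; lra.
have w0 : 0 <= w%:R :> R by [].
by rewrite expr2; nra.
Qed.

Lemma cdistC (z z' : cell) : cdist R z z' = cdist R z' z.
Proof. by rewrite /cdist distrC [X in _ + X]distrC. Qed.

(** Boundary points stay fixed and any other point goes to a point of Y in the box that [phi]
    assigns to it. The two rules agree up to a constant because [phi] moves edge cells a bounded
    distance. The factor 2 on [M] compares the l1 and Euclidean distances, and [H] replaces [h] to
    keep the constants free of [n]. *)
Lemma embeds_of_spreads pts ys (B : {set cell}) (M D E C H : R) :
  0 <= M -> 0 <= D -> h <= H -> spreads (occupied pts) B M D E C ->
  (forall y, y \in ys -> exists2 z, z \in B & cbox z y) ->
  (forall z, z \in B -> exists2 y, y \in ys & cbox z y) ->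
  embeds n (Xspace n pts) (Xspace n ys) (2 * M + 1)
    (2 * (H * (2 + `|E|)) * (1 + M) + 4 * H * (1 + M) + 2 * H * D + 1)
    (H * (2 + `|E|) + H * (`|C| + 4 * M + D) + 2 * H + 1).
Proof.
move=> M0 D0 hH [phi [[lip edge] phiB Bphi]] ysB Bys.
have H0 : 0 < H := lt_le_trans h_gt0 hH.
set E1 := H * (2 + `|E|).
have hE (x : R) : h * x <= H * `|x|.
  apply: (@le_trans _ _ (h * `|x|)); first by rewrite ler_wpM2l ?ler_norm// ltW.
  by rewrite ler_wpM2r.
have /choice[T HT] : forall x, exists y, Xspace n pts x ->
    [/\ Xspace n ys y, bdry n x -> y = x &
        l1 y (corner (phi (cellof x))) <= E1].
  move=> x.
  case: (pselect (bdry n x)) => [bx|nbx].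
    exists x => _; split => //; first by right.
    have := l1_tri x (corner (cellof x)) (corner (phi (cellof x))).
    have := near_corner bx.1; rewrite corner_dist cdistC /E1.
    have := hE E; have := ler_wpM2l (ltW h_gt0) (edge _ (edge_cellof bx)); lra.
  case: (pselect (Xspace n pts x)) => [Xx|nX]; last by exists x.
  case: Xx => [[xp xn]|//].
  have [y yys yb] := Bys _ (phiB _ (occupied_cellof xp xn)).
  exists y => _; split => //; first by left; split => //; exact: cbox_inbox yb.
  have := cbox_near yb; rewrite /E1; have := mulr_ge0 (ltW H0) (normr_ge0 E); lra.
have inX x : Xspace n pts x -> inbox n x by case => [[]|[]].
have close x1 x2 : Xspace n pts x1 -> Xspace n pts x2 ->
    `|l1 x1 x2 - h * cdist R (cellof x1) (cellof x2)| <= 4 * H.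
  move=> /inX/near_corner a /inX/near_corner b; rewrite -corner_dist.
  move: a b; move: (corner (cellof x1)) (corner (cellof x2)) => y1 y2 a b.
  have := l1_tri x1 y1 x2; have := l1_tri y1 y2 x2.
  have := l1_tri y1 x1 y2; have := l1_tri x1 x2 y2.
  rewrite (l1C y1 x1) (l1C y2 x2) ler_norml => *; apply/andP; split; lra.
have closeT x1 x2 : Xspace n pts x1 -> Xspace n pts x2 ->
    `|l1 (T x1) (T x2) - h * cdist R (phi (cellof x1)) (phi (cellof x2))| <= 2 * E1.
  move=> /HT[_ _ a] /HT[_ _ b]; rewrite -corner_dist.
  move: a b; move: (corner (phi (cellof x1))) (corner (phi (cellof x2))) => y1 y2 a b.
  have := l1_tri (T x1) y1 (T x2); have := l1_tri y1 y2 (T x2).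
  have := l1_tri y1 (T x1) y2; have := l1_tri (T x1) (T x2) y2.
  rewrite (l1C y1 (T x1)) (l1C y2 (T x2)) ler_norml => *; apply/andP; split; lra.
have E10 : 0 <= E1 by rewrite mulr_ge0 ?(ltW H0)// addr_ge0.
have ME1 : 0 <= M * E1 by rewrite mulr_ge0.
have MH : 0 <= M * H by rewrite mulr_ge0// ltW.
have HD : 0 <= H * D by rewrite mulr_ge0// ltW.
have hD : h * D <= H * D by rewrite ler_wpM2r.
have ed0 p q : 0 <= edist p q :> R by exact: sqrtr_ge0.
exists T; split; last by move=> p bp; have [_ ->] := HT p (or_intror bp).
split; first by move=> x /HT[].
split => [x1 x2 X1 X2|y Yy].
  have := close _ _ X1 X2; have := closeT _ _ X1 X2.
  have [up lo] := lip (cellof x1) (cellof x2).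
  have {up}up := ler_wpM2l (ltW h_gt0) up.
  have {lo}lo := ler_wpM2l (ltW h_gt0) lo.
  rewrite !ler_norml => /andP[a b] /andP[c d].
  have e1 := edist_le_l1 x1 x2; have e2 := l1_le_edist x1 x2.
  have e3 := edist_le_l1 (T x1) (T x2); have e4 := l1_le_edist (T x1) (T x2).
  have f1 := ed0 x1 x2; have f2 := ed0 (T x1) (T x2).
  move: (edist x1 x2) (edist (T x1) (T x2)) e1 e2 e3 e4 f1 f2 => u v e1 e2 e3 e4 f1 f2.
  move: (l1 x1 x2) (l1 (T x1) (T x2)) e1 e2 e3 e4 a b c d => p q e1 e2 e3 e4 a b c d.
  move: (cdist R (phi (cellof x1)) (phi (cellof x2))) (cdist R (cellof x1) (cellof x2))
    up lo a b c d => x y up lo a b c d.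
  have K (s t : R) : s <= t -> M * s <= M * t by exact: ler_wpM2l.
  split.
    rewrite lerBlDr ler_pdivrMr; last by lra.
    have k1 : M * (h * x) <= M * (q + 2 * E1) by apply: K; lra.
    have k2 : M * q <= M * (2 * v) by apply: K.
    have k3 : u <= (2 * M + 1) * v + (2 * M * E1 + H * D + 4 * H) by lra.
    apply: (le_trans k3); rewrite [leRHS]mulrC mulrDr; apply: lerD => //.
    have M1 : 1 <= 2 * M + 1 by lra.
    apply: (@le_trans _ _ (2 * E1 * (1 + M) + 4 * H * (1 + M) + 2 * H * D + 1)); first by lra.
    by rewrite ler_peMl//; lra.
  have k1 : M * (h * y) <= M * (p + 4 * H) by apply: K; lra.
  have k2 : M * p <= M * (2 * u) by apply: K.
  by lra.
case: Yy => [[yys yn]|yb]; last first.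
  exists y; first by right.
  have [_ -> // _] := HT y (or_intror yb).
  rewrite /edist !subrr expr0n /= addr0 sqrtr0.
  have := mulr_ge0 (ltW H0) (normr_ge0 C); lra.
have [c cB yc] := ysB _ yys; have [z zA zc] := Bphi _ cB.
move: zA; rewrite inE => /asboolP[p [pp pn zp]].
have Xp : Xspace n pts p by left.
exists p => //; apply: le_trans (edist_le_l1 _ _) _.
have [_ _ a] := HT p Xp.
have := l1_tri (T p) (corner (phi (cellof p))) y.
have := l1_tri (corner (phi (cellof p))) (corner c) y.
have := cbox_near yc; rewrite (l1C y) corner_dist.
(* The point [p] is only within 4 cells of [z]; the Lipschitz bound of [phi] turns this into
   [M * 4 + D]. *)
have k : cdist R (phi (cellof p)) c <= C + (M * 4 + D).
  rewrite cdistC; apply: le_trans (cdist_tri R _ (phi z) _) _.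
  apply: lerD => //; have [u _] := lip z (cellof p).
  by apply: le_trans u _; rewrite lerD2r ler_wpM2l.
have := ler_wpM2l (ltW h_gt0) k; rewrite mulrDr.
have := hE C.
have : h * (M * 4 + D) <= H * (M * 4 + D) by rewrite ler_wpM2r// addr_ge0// mulr_ge0.
lra.
Qed.

(** A covered cell costs at most a factor [exp(-(2 + 2h))], an empty one [exp(-h^2)]. At most a
    share [eps / 2] of the cells is empty, and [8 <= eps * h] gives [2 + 2h <= 4h <= (eps / 2) h^2],
    so both costs fit into [eps * n ^+ 2]. *)
Lemma poisson_weight_ge (eps : R) (b : nat) : 4 <= h -> 0 < eps -> 8 <= eps * h ->
  (1 - eps / 2) * (2 ^ m)%:R ^+ 2 <= b%:R ->
  expR (- (eps * n%:R ^+ 2)) <= expR (- (n%:R ^+ 2)) *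
   ((h ^+ 2) ^+ Num.truncn (h ^+ 2) / (Num.truncn (h ^+ 2))`!%:R) ^+ b.
Proof.
move=> h4 e0 eh hb; set r := Num.truncn (h ^+ 2).
have h2 : 0 <= h ^+ 2 := sqr_ge0 h.
have /andP[r1 r2] := truncn_near h2; rewrite -/r in r1 r2.
have r0 : (0 < r)%N by rewrite /r truncn_gt0; nra.
have F : expR (r%:R - 1 - 2 * h) <= (h ^+ 2) ^+ r / r`!%:R.
  have f0 : 0 < r`!%:R :> R by rewrite ltr0n fact_gt0.
  apply: (@le_trans _ _ (expR (r%:R - 1) / r.+1%:R)).
    rewrite expRB ler_wpM2l ?expR_ge0// lef_pV2 ?posrE ?expR_gt0//.
    have := expR_ge1Dx h => e1.
    have -> : expR (2 * h) = expR h ^+ 2 by rewrite -expRM_natl.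
    rewrite -natr1; have : (1 + h) ^+ 2 <= expR h ^+ 2.
      by rewrite lerXn2r ?nnegrE ?expR_ge0//; lra.
    by nra.
  apply: (le_trans (pow_fact_ge R r0)); rewrite ler_pM2r ?invr_gt0//.
  by rewrite lerXn2r ?nnegrE.
apply: (@le_trans _ _ (expR (- (n%:R ^+ 2)) * expR (r%:R - 1 - 2 * h) ^+ b)); last first.
  by rewrite ler_wpM2l ?expR_ge0// lerXn2r ?nnegrE ?expR_ge0// (le_trans (expR_ge0 _) F).
rewrite -expRM_natl -expRD ler_expR -hn.
have y0 : 0 <= h ^+ 2 - 2 - 2 * h by nra.
have b0 : 0 <= b%:R :> R by [].
have k1 : b%:R * (h ^+ 2 - 2 - 2 * h) <= b%:R * (r%:R - 1 - 2 * h).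
  by rewrite ler_wpM2l//; lra.
have k2 := ler_wpM2r y0 hb.
have N0 : 0 <= (2 ^ m)%:R ^+ 2 :> R := sqr_ge0 _.
have k3 : 4 * h <= eps / 2 * h ^+ 2 by nra.
have k4 := ler_wpM2l N0 k3.
have k5 : 0 <= eps * ((2 ^ m)%:R ^+ 2 * (1 + h)).
  by rewrite mulr_ge0 ?(ltW e0)// mulr_ge0//; lra.
have k6 : (2 ^ m)%:R ^+ 2 * (2 + 2 * h) <= (2 ^ m)%:R ^+ 2 * (4 * h) :> R.
  by rewrite ler_wpM2l//; lra.
rewrite exprMn; move: ((2 ^ m)%:R ^+ 2) hb k2 N0 k4 k5 k6 => N *.
by lra.
Qed.

End Grid.

Theorem theorem2 (R : realType) (eps delta : R) :
  0 < eps -> 0 < delta ->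
  exists M D C : R, [/\ 0 < M, 0 < D & 0 < C] /\
  exists N : nat, forall n : nat, (N <= n)%N ->
    forall pts : seq (R * R),
      delta * (n%:R ^+ 2) <= (kX n pts)%:R ->
      poisson_prob_ge n
        (fun ys : seq (R * R) => embeds n (Xspace n pts) (Xspace n ys) M D C)
        (expR (- (eps * n%:R ^+ 2))).
Proof.
move=> e0 d0.
have e20 : 0 < eps / 2 by rewrite divr_gt0.
(* The 4 is the one in [card_occupied]: a share [delta] of unit squares gives at least a share
   [delta / 4] of occupied cells. *)
have d40 : 0 < delta / 4 by rewrite divr_gt0.
have [M [D [E [C [M0 D0 spread]]]]] := spread_dense e20 d40.
(* A lower bound for the mesh that meets both size conditions of [poisson_weight_ge]. The mesh [h]
   will lie between [s] and [2 * s], whatever [n] is. *)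
pose s := (4 + Num.truncn (8 / eps))%N.
have s0 : (0 < s)%N by [].
have s4 : 4 <= s%:R :> R by rewrite ler_nat leq_addr.
have se : 8 <= eps * s%:R.
  have := truncn_near (divr_ge0 (ler0n R 8) (ltW e0)) => /andP[_].
  rewrite ltr_pdivrMr// => /ltW /le_trans; apply.
  have st : (Num.truncn (8 / eps) < s)%N by rewrite /s -add1n leq_add2r.
  by rewrite mulrC ler_wpM2l ?(ltW e0)// natr1 ler_nat.
pose H : R := 2 * s%:R.
have H0 : 0 < H by rewrite mulr_gt0// ltr0n.
have E0 : 0 <= H * (2 + `|E|) by rewrite mulr_ge0 ?(ltW H0)// addr_ge0.
exists (2 * M + 1), (2 * (H * (2 + `|E|)) * (1 + M) + 4 * H * (1 + M) + 2 * H * D + 1),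
  (H * (2 + `|E|) + H * (`|C| + 4 * M + D) + 2 * H + 1); split.
  have a1 := mulr_ge0 E0 M0; have a2 := mulr_ge0 (ltW H0) M0.
  have a3 := mulr_ge0 (ltW H0) D0; have a4 := mulr_ge0 (ltW H0) (normr_ge0 C).
  by split; lra.
exists s => n sn pts hk.
have [m /andP[m1 m2]] := grid_scale s0 sn.
have N0 : 0 < (2 ^ m)%:R :> R := pow2_gt0 R m.
pose h : R := n%:R / (2 ^ m)%:R.
have hn : h * (2 ^ m)%:R = n%:R by rewrite /h divfK// gt_eqF.
have sh : s%:R <= h by rewrite /h ler_pdivlMr// -natrM ler_nat.
have hH : h <= H.
  rewrite /h ler_pdivrMr// /H -!natrM ler_nat (leq_trans (ltnW m2))//.
  by rewrite expnS mulnCA mulnA.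
have h0 : 0 < h by lra.
have cA : delta / 4 * (2 ^ m)%:R ^+ 2 <= #|occupied m n h pts|%:R.
  have h1 : 1 <= h by lra.
  have := le_trans hk (card_occupied h0 hn pts h1).
  rewrite -hn exprMn => k.
  rewrite -(ler_pM2l (_ : 0 < 4 * h ^+ 2)); last by rewrite mulr_gt0// exprn_gt0.
  by apply: le_trans k; rewrite le_eqVlt; apply/orP; left; apply/eqP; field.
have [B sB cB] := spread m _ cA.
apply: (@poisson_prob_ge_boxes R _ (@cbox R m h) (h ^+ 2) _ _ _ _ n B (Num.truncn (h ^+ 2))).
- exact: measurable_cbox.
- exact: leb2_cbox.
- by move=> i j x; exact: (cbox_disj h0).
- exact: sqr_ge0.
- by rewrite truncn_gt0; nra.
- by move=> i x _; exact: (cbox_inbox h0 hn).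
- by move=> ys; exact: (embeds_of_spreads h0 hn M0 D0 hH sB).
- apply: (poisson_weight_ge hn _ e0 _ cB); first by lra.
  by apply: le_trans se _; rewrite ler_wpM2l ?(ltW e0).
Qed.
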